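(* Let $R$ be an integral domain with quotient field $K$. The following are equivalent: (1) $R$ is a P$v$MD. (2) $\operatorname{Tor}^R_2(M,N)$ is GV-torsion for every pair of $R$-modules $M,N$ (equivalently, the $w$-weak global dimension of $R$ is $\le 1$). (3) For every $R$-module $X$ and every torsion-free $R$-module $A$, $\operatorname{Tor}^R_1(X,A)$ is GV-torsion. (4) For every pair of $K$-algebras $\mathcal T,\mathcal S$ and every pair of $R$-subalgebras $A\subseteq\mathcal T$, $B\subseteq\mathcal S$, the canonical map $\mu_{A,B}\colon A\otimes_R B\to\mathcal T\otimes_K\mathcal S$ has GV-torsion kernel (equivalently, the localization $(\mu_{A,B})_{\mathfrak m}$ is injective for all $\mathfrak m\in w\text{-}\mathrm{Max}(R)$).
   Context: $R$ is an integral domain with $1\ne 0$; modules are unitary. A finitely generated ideal $J$ of $R$ is a GV-ideal, $J\in \mathrm{GV}(R)$, if the natural map $R\to\operatorname{Hom}_R(J,R)$, $r\mapsto (x\mapsto rx)$, is an isomorphism. An $R$-module $M$ is GV-torsion if for every $x\in M$ there is $J\in\mathrm{GV}(R)$ with $Jx=0$, and GV-torsion-free if $Jx=0$ with $J\in\mathrm{GV}(R)$, $x\in M$ forces $x=0$. For $M$ GV-torsion-free with injective envelope $E(M)$, $M_w=\{x\in E(M): Jx\subseteq M\text{ for some }J\in \mathrm{GV}(R)\}$, and $M$ is a $w$-module if $M_w=M$. A $w$-ideal is an ideal of $R$ that is a $w$-module; $w\text{-}\mathrm{Max}(R)$ is the set of ideals maximal among proper $w$-ideals (these are prime). A sequence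 is $w$-exact if its localization at every $\mathfrak m\in w\text{-}\mathrm{Max}(R)$ is exact. $R$ is a P$v$MD (Prüfer $v$-multiplication domain) if every nonzero finitely generated ideal $I$ of $R$ is $w$-invertible, i.e. $(II^{-1})_w=R$, where $I^{-1}=\{x\in K: Ix\subseteq R\}$. An $R$-module $F$ is $w$-flat if $\operatorname{Tor}^R_1(N,F)$ is GV-torsion for all $R$-modules $N$. The $w$-weak global dimension of $R$ is $\le n$ if every $R$-module $M$ admits a $w$-exact sequence $0\to F_n\to\cdots\to F_0\to M\to 0$ with every $F_i$ $w$-flat. *)

(* Defs.v *)
From HB Require Import structures.
From mathcomp Require Import all_boot all_algebra.
From mathcomp Require Import ring_quotient fraction.
From mathcomp Require Import finmap monalg ring.
From mathcomp Require Import boolp classical_sets.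

Set Implicit Arguments.
Unset Strict Implicit.
Unset Printing Implicit Defensive.

Import GRing.Theory.
Local Open Scope ring_scope.
Local Open Scope quotient_scope.
Local Open Scope classical_set_scope.

(* Submodules are predicates S : submodClosed V.  Over a ring they are closed
   under opposite, as - x = -1 *: x. *)

Section Submodules.
Variables (R : pzRingType) (V : lmodType R).

Record submod (S : submodClosed V) := Submod { sub_val : V; _ : sub_val \in S }.

HB.instance Definition _ (S : submodClosed V) := [isSub for @sub_val S].
HB.instance Definition _ (S : submodClosed V) := [Choice of submod S by <:].

Lemma submod_closedP (S : submodClosed V) : submod_closed S.
Proof.
split=> [|a u v uS vS]; first exact: rpred0.
by apply: rpredD => //; apply: rpredZ.
Qed.

HB.instance Definition _ (S : submodClosed V) :=
  [SubChoice_isSubLmodule of submod S by <:].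

Lemma submod_oppr_closed (S : submodClosed V) : oppr_closed S.
Proof. by move=> x xS; rewrite -scaleN1r rpredZ. Qed.

Definition submod_zmod (S : submodClosed V) : zmodClosed V :=
  HB.pack (GRing.SubmodClosed.sort S)
    (GRing.isOppClosed.Build V (GRing.SubmodClosed.sort S) (@submod_oppr_closed S)).

Definition spanm (X : set V) : {pred V} := fun v =>
  `[< exists2 s : seq (R * V), {in s, forall p, X p.2}
      & v = \sum_(p <- s) p.1 *: p.2 >].

Lemma spanm_submod_closed (X : set V) : submod_closed (spanm X).
Proof.
split; first by apply/asboolP; exists [::]; rewrite ?big_nil.
move=> a u v /asboolP[s sX ->] /asboolP[t tX ->]; apply/asboolP.
exists ([seq (a * p.1, p.2) | p <- s] ++ t).
  by move=> p; rewrite mem_cat => /orP[/mapP[q qs ->]|/tX//]; apply: sX qs.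
rewrite big_cat big_map scaler_sumr; congr (_ + _).
by apply: eq_bigr => p _; rewrite scalerA.
Qed.

HB.instance Definition _ (X : set V) :=
  GRing.isSubmodClosed.Build R V (spanm X) (spanm_submod_closed X).

Definition fin_gen (S : submodClosed V) :=
  exists s : seq V, S =i spanm [set x | x \in s].

End Submodules.

Section KernelImage.
Variables (R : pzRingType) (U V : lmodType R).

Definition ker (f : U -> V) : {pred U} := fun x => f x == 0.
Definition im (f : U -> V) : {pred V} := fun y => `[< exists x, f x = y >].
Definition preim_pred (f : U -> V) (S : {pred V}) : {pred U} := fun x => f x \in S.

Lemma ker_submod_closed (f : {linear U -> V}) : submod_closed (ker f).
Proof.
split; first by rewrite unfold_in /ker linear0.
by move=> a u v /eqP fu /eqP fv; rewrite unfold_in /ker linearP fu fv scaler0 addr0.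
Qed.

HB.instance Definition _ (f : {linear U -> V}) :=
  GRing.isSubmodClosed.Build R U (ker f) (ker_submod_closed f).

Lemma im_submod_closed (f : {linear U -> V}) : submod_closed (im f).
Proof.
split; first by apply/asboolP; exists 0; rewrite linear0.
move=> a _ _ /asboolP[x <-] /asboolP[y <-].
by apply/asboolP; exists (a *: x + y); rewrite linearP.
Qed.

HB.instance Definition _ (f : {linear U -> V}) :=
  GRing.isSubmodClosed.Build R V (im f) (im_submod_closed f).

Lemma preim_submod_closed (f : {linear U -> V}) (S : submodClosed V) :
  submod_closed (preim_pred f S).
Proof.
split; first by rewrite unfold_in /preim_pred linear0 rpred0.
move=> a u v fu fv; rewrite unfold_in /preim_pred linearP.
by apply: rpredD => //; apply: rpredZ.
Qed.

HB.instance Definition _ (f : {linear U -> V}) (S : submodClosed V) :=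
  GRing.isSubmodClosed.Build R U (preim_pred f S) (preim_submod_closed f S).

End KernelImage.

Section QuotientModule.
Variables (R : pzRingType) (V : lmodType R) (S : submodClosed V).

Definition quotm : Type := Quotient.quot (submod_zmod S).
HB.instance Definition _ := GRing.Zmodule.on quotm.

Definition quot_pi (x : V) : quotm := \pi_(Quotient.quot (submod_zmod S)) x.

Lemma quot_piP x y : quot_pi x = quot_pi y <-> x - y \in S.
Proof.
rewrite /quot_pi; split => [/eqP|xyS]; first by rewrite -Quotient.idealrBE.
by apply/eqP; rewrite -Quotient.idealrBE.
Qed.

Lemma quot_pi_repr (q : quotm) : quot_pi (repr q) = q.
Proof. exact: reprK. Qed.

Lemma quot_piD x y : quot_pi (x + y) = quot_pi x + quot_pi y.
Proof. by rewrite /quot_pi raddfD. Qed.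

Definition quot_scale (a : R) (q : quotm) : quotm := quot_pi (a *: repr q).

Lemma quot_scaleE a x : quot_scale a (quot_pi x) = quot_pi (a *: x).
Proof.
apply/quot_piP; rewrite -scalerBr; apply: rpredZ.
by apply/quot_piP; rewrite quot_pi_repr.
Qed.

Fact quot_scaleA a b q : quot_scale a (quot_scale b q) = quot_scale (a * b) q.
Proof. by rewrite -[q]quot_pi_repr !quot_scaleE scalerA. Qed.
Fact quot_scale1 : left_id 1 quot_scale.
Proof. by move=> q; rewrite -[q]quot_pi_repr quot_scaleE scale1r. Qed.
Fact quot_scaleDr : right_distributive quot_scale +%R.
Proof.
move=> a p q; rewrite -[p]quot_pi_repr -[q]quot_pi_repr -quot_piD !quot_scaleE.
by rewrite -quot_piD scalerDr.
Qed.
Fact quot_scaleDl q : {morph quot_scale^~ q : a b / a + b}.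
Proof.
by move=> a b; rewrite -[q]quot_pi_repr !quot_scaleE -quot_piD scalerDl.
Qed.

HB.instance Definition _ := GRing.Zmodule_isLmodule.Build R quotm
  quot_scaleA quot_scale1 quot_scaleDr quot_scaleDl.

Fact quot_pi_is_linear : linear quot_pi.
Proof. by move=> a x y; rewrite quot_piD -quot_scaleE. Qed.

HB.instance Definition _ := GRing.isLinear.Build R V quotm *:%R quot_pi
  quot_pi_is_linear.

(* The map induced by f on V / S; meaningful when f vanishes on S. *)
Definition quot_lift (W : Type) (f : V -> W) (q : quotm) : W := f (repr q).

Lemma quot_liftE (W : lmodType R) (f : {linear V -> W}) x :
  {in S, forall y, f y = 0} -> quot_lift f (quot_pi x) = f x.
Proof.
move=> fS; apply/eqP; rewrite -subr_eq0 -linearB fS //.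
by apply/quot_piP; rewrite quot_pi_repr.
Qed.

End QuotientModule.


Section FreeModule.
Variables (R : nzRingType).

Definition free_mod (X : choiceType) : lmodType R := malg X R.
Definition free_gen (X : choiceType) (x : X) : free_mod X := mkmalgU x 1.

Variables (X : choiceType) (V : lmodType R).

Definition free_lift (f : X -> V) (g : free_mod X) : V :=
  \sum_(x <- msupp g) mcoeff x g *: f x.

Variable f : X -> V.

Lemma free_liftEw (d : {fset X}) (g : free_mod X) :
  (msupp g `<=` d)%fset -> free_lift f g = \sum_(x <- d) mcoeff x g *: f x.
Proof.
move=> le; rewrite /free_lift; apply: big_fset_incl => // x _ /mcoeff_outdom ->.
by rewrite scale0r.
Qed.

Fact free_lift_is_linear : linear (free_lift f).
Proof.
move=> a g h.
pose d := (msupp g `|` msupp h `|` msupp (a *: g + h))%fset.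
rewrite (@free_liftEw d) ?fsubsetUr // (@free_liftEw d g); last first.
  by rewrite /d -fsetUA fsubsetUl.
rewrite (@free_liftEw d h); last by rewrite /d fsetUAC fsubsetUr.
rewrite scaler_sumr -big_split; apply: eq_bigr => x _.
by rewrite mcoeffD mcoeffZ scalerDl scalerA.
Qed.

HB.instance Definition _ := GRing.isLinear.Build R (free_mod X) V *:%R
  (free_lift f) free_lift_is_linear.

Lemma free_lift_gen x : free_lift f (free_gen x) = f x.
Proof.
rewrite (@free_liftEw [fset x]%fset) ?msuppU_le // big_seq_fset1 mcoeffUU.
by rewrite scale1r.
Qed.

End FreeModule.


Section TensorProduct.
Variables (R : comNzRingType) (M N : lmodType R).
Local Notation gen m n := (free_gen R (m, n)).

Variant tens_rel : set (free_mod R (M * N)%type) :=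
| TensDl m m' n : tens_rel (gen (m + m') n - (gen m n + gen m' n))
| TensDr m n n' : tens_rel (gen m (n + n') - (gen m n + gen m n'))
| TensZl a m n : tens_rel (gen (a *: m) n - a *: gen m n)
| TensZr a m n : tens_rel (gen m (a *: n) - a *: gen m n).

Definition tens : lmodType R := quotm (spanm tens_rel).
Definition tensor (m : M) (n : N) : tens := quot_pi (spanm tens_rel) (gen m n).

Lemma tens_rel_pi g h : tens_rel (g - h) ->
  quot_pi (spanm tens_rel) g = quot_pi (spanm tens_rel) h.
Proof.
move=> gP; apply/quot_piP; apply/asboolP; exists [:: (1, g - h)].
  by move=> p; rewrite inE => /eqP->.
by rewrite big_seq1 scale1r.
Qed.

Fact tensor_is_bilinear : bilinear_for *:%R *:%R tensor.
Proof.
split=> [n a m m' | m a n n']; rewrite /tensor.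
- rewrite (tens_rel_pi (TensDl _ _ _)) quot_piD.
  by rewrite (tens_rel_pi (TensZl _ _ _)) linearZ.
- rewrite (tens_rel_pi (TensDr _ _ _)) quot_piD.
  by rewrite (tens_rel_pi (TensZr _ _ _)) linearZ.
Qed.

HB.instance Definition _ := bilinear_isBilinear.Build R M N tens *:%R *:%R
  tensor tensor_is_bilinear.

Definition tens_lift (W : lmodType R) (b : M -> N -> W) : tens -> W :=
  quot_lift (free_lift (fun p : M * N => b p.1 p.2)).

Variables (W : lmodType R) (b : {bilinear M -> N -> W}).

Lemma tens_lift_pi g : tens_lift b (quot_pi (spanm tens_rel) g) =
  free_lift (fun p : M * N => b p.1 p.2) g.
Proof.
pose L : {linear free_mod R (M * N)%type -> W} :=
  free_lift (fun p : M * N => b p.1 p.2).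
have LE m n : L (gen m n) = b m n by rewrite /= free_lift_gen.
apply: (quot_liftE (f := L)) => _ /asboolP[s sP ->].
rewrite linear_sum big_seq big1 // => p /sP pP; rewrite linearZ /=.
suff -> : L p.2 = 0 by rewrite scaler0.
case: pP => *; rewrite linearB; apply/eqP; rewrite subr_eq0.
- by rewrite linearD !LE linearDl.
- by rewrite linearD !LE linearDr.
- by rewrite linearZ !LE linearZl_LR.
- by rewrite linearZ !LE linearZr_LR.
Qed.

Lemma tens_liftE m n : tens_lift b (tensor m n) = b m n.
Proof. by rewrite tens_lift_pi free_lift_gen. Qed.

Fact tens_lift_is_linear : linear (tens_lift b).
Proof.
move=> a x y; rewrite -[x]quot_pi_repr -[y]quot_pi_repr -linearP.
by rewrite !tens_lift_pi linearP.
Qed.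

HB.instance Definition _ := GRing.isLinear.Build R tens W *:%R
  (tens_lift b) tens_lift_is_linear.

End TensorProduct.

Section TensorMap.
Variables (R : comNzRingType) (M M' N : lmodType R) (f : {linear M -> M'}).

Definition tens_map_bil (m : M) (n : N) : tens M' N := tensor (f m) n.

Fact tens_map_is_bilinear : bilinear_for *:%R *:%R tens_map_bil.
Proof.
split=> [n a m m' | m a n n']; rewrite /tens_map_bil /=.
  by rewrite linearP linearPl.
by rewrite linearPr.
Qed.

HB.instance Definition _ := bilinear_isBilinear.Build R M N (tens M' N)
  *:%R *:%R tens_map_bil tens_map_is_bilinear.

Definition tens_map : {linear tens M N -> tens M' N} := tens_lift tens_map_bil.

Lemma tens_mapE m n : tens_map (tensor m n) = tensor (f m) n.
Proof. exact: tens_liftE. Qed.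

End TensorMap.

Section Tor.
Variables (R : comNzRingType).

Definition free_cover (V : lmodType R) : {linear free_mod R V -> V} :=
  free_lift (fun v : V => v).

Variable M : lmodType R.

(* Tor is computed from the canonical free resolution of M, whose n-th term is
   the free module on the n-th syzygy. *)
Fixpoint syz (n : nat) : lmodType R :=
  if n is n'.+1 then submod (ker (free_cover (syz n'))) else M.

Definition res (n : nat) : lmodType R := free_mod R (syz n).

Definition res_diff (n : nat) : res n.+1 -> res n :=
  fun x => val (free_cover (syz n.+1) x).

Fact res_diff_is_linear n : linear (@res_diff n).
Proof. by move=> a x y; rewrite /res_diff !linearP. Qed.

HB.instance Definition _ n := GRing.isLinear.Build R (res n.+1) (res n) *:%R
  (@res_diff n) (@res_diff_is_linear n).

Variable N : lmodType R.

Definition cycles (n : nat) : {pred tens (res n) N} :=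
  match n with
  | 0 => predT
  | n'.+1 => ker (tens_map N (@res_diff n'))
  end.
Arguments cycles : clear implicits.

Fact cycles_submod_closed n : submod_closed (cycles n).
Proof. by case: n => [|n]; [split | exact: submod_closedP]. Qed.

HB.instance Definition _ n := GRing.isSubmodClosed.Build R (tens (res n) N)
  (cycles n) (cycles_submod_closed n).

Definition boundaries (n : nat) : {pred tens (res n) N} :=
  im (tens_map N (@res_diff n)).

Arguments boundaries : clear implicits.

HB.instance Definition _ n := GRing.SubmodClosed.on (boundaries n).

Definition Tor (n : nat) : lmodType R :=
  quotm (preim_pred (val : submod (cycles n) -> _) (boundaries n)).

End Tor.

Section Localization.
Variables (R : comNzRingType) (S : mulrClosed R) (M : lmodType R).

Definition frac_pair : choiceType := (M * {s : R | s \in S})%type.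
Implicit Types x y z : frac_pair.
Local Notation den x := (sval x.2).

Definition frac_equiv (x y : frac_pair) : bool :=
  `[< exists2 u, u \in S & (u * den y) *: x.1 = (u * den x) *: y.1 >].

Fact frac_equiv_class : equiv_class_of frac_equiv.
Proof.
split=> [x|x y|y x z].
- by apply/asboolP; exists 1; rewrite ?rpred1.
- by apply/asboolP/asboolP => -[u uS e]; exists u.
- move=> /asboolP[u uS e] /asboolP[v vS e']; apply/asboolP.
  exists (u * v * den y); first by rewrite !rpredM ?(svalP y.2).
  have -> : u * v * den y * den z = (v * den z) * (u * den y).
    by ring.
  rewrite -scalerA e scalerA.
  have -> : v * den z * (u * den x) = (u * den x) * (v * den z) by rewrite mulrC.
  rewrite -scalerA e' scalerA; congr (_ *: _).
  by ring.
Qed.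

Canonical frac_equiv_equiv := EquivRelPack frac_equiv_class.
Canonical frac_equiv_encModRel := defaultEncModRel frac_equiv.

Definition loc : Type := {eq_quot frac_equiv}.
HB.instance Definition _ := Choice.on loc.


Definition loc_pi (x : frac_pair) : loc := \pi_({eq_quot frac_equiv}) x.

Lemma loc_piP x y : loc_pi x = loc_pi y <->
  exists2 u, u \in S & (u * den y) *: x.1 = (u * den x) *: y.1.
Proof.
rewrite /loc_pi; split=> [/eqquotP/asboolP//|h].
by apply/eqquotP/asboolP.
Qed.

Lemma loc_pi_repr (q : loc) : loc_pi (repr q) = q.
Proof. exact: reprK. Qed.

Definition den_one : {s : R | s \in S} := exist _ 1 (rpred1 S).
Definition den_mul (s t : {s : R | s \in S}) : {s : R | s \in S} :=
  exist _ (sval s * sval t) (rpredM (svalP s) (svalP t)).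

Definition frac_add x y : frac_pair :=
  (den y *: x.1 + den x *: y.1, den_mul x.2 y.2).
Definition frac_opp x : frac_pair := (- x.1, x.2).
Definition frac_scale (a : R) x : frac_pair := (a *: x.1, x.2).

Definition loc_add (p q : loc) : loc := loc_pi (frac_add (repr p) (repr q)).
Definition loc_opp (p : loc) : loc := loc_pi (frac_opp (repr p)).
Definition loc_scale (a : R) (p : loc) : loc := loc_pi (frac_scale a (repr p)).

Lemma loc_addE x y : loc_add (loc_pi x) (loc_pi y) = loc_pi (frac_add x y).
Proof.
rewrite /loc_add; set x' := repr (loc_pi x); set y' := repr (loc_pi y).
have /loc_piP[u uS ex] : loc_pi x' = loc_pi x by exact: loc_pi_repr.
have /loc_piP[v vS ey] : loc_pi y' = loc_pi y by exact: loc_pi_repr.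
apply/loc_piP; exists (u * v); first exact: rpredM.
rewrite /= !scalerDr !scalerA; congr (_ + _).
- transitivity ((v * den y * den y') *: ((u * den x) *: x'.1)).
    by rewrite scalerA; congr (_ *: _); ring.
  by rewrite ex scalerA; congr (_ *: _); ring.
- transitivity ((u * den x * den x') *: ((v * den y) *: y'.1)).
    by rewrite scalerA; congr (_ *: _); ring.
  by rewrite ey scalerA; congr (_ *: _); ring.
Qed.

Lemma loc_oppE x : loc_opp (loc_pi x) = loc_pi (frac_opp x).
Proof.
rewrite /loc_opp; set x' := repr (loc_pi x).
have /loc_piP[u uS ex] : loc_pi x' = loc_pi x by exact: loc_pi_repr.
by apply/loc_piP; exists u; rewrite //= !scalerN ex.
Qed.

Lemma loc_scaleE a x : loc_scale a (loc_pi x) = loc_pi (frac_scale a x).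
Proof.
rewrite /loc_scale; set x' := repr (loc_pi x).
have /loc_piP[u uS ex] : loc_pi x' = loc_pi x by exact: loc_pi_repr.
apply/loc_piP; exists u => //=.
transitivity (a *: ((u * den x) *: x'.1)).
  by rewrite !scalerA; congr (_ *: _); ring.
by rewrite ex !scalerA; congr (_ *: _); ring.
Qed.

Lemma loc_pi_eq x y : den y *: x.1 = den x *: y.1 -> loc_pi x = loc_pi y.
Proof. by move=> e; apply/loc_piP; exists 1; rewrite ?rpred1 // !mul1r. Qed.

Fact loc_addA : associative loc_add.
Proof.
move=> p q r; rewrite -[p]loc_pi_repr -[q]loc_pi_repr -[r]loc_pi_repr !loc_addE.
apply: loc_pi_eq; rewrite /= !scalerDr !scalerA !addrA.
by congr (_ *: _ + _ *: _ + _ *: _); ring.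
Qed.

Fact loc_addC : commutative loc_add.
Proof.
move=> p q; rewrite -[p]loc_pi_repr -[q]loc_pi_repr !loc_addE.
apply: loc_pi_eq; rewrite /= [in RHS]addrC !scalerDr !scalerA.
by congr (_ *: _ + _ *: _); ring.
Qed.

Fact loc_add0 : left_id (loc_pi (0, den_one)) loc_add.
Proof.
move=> p; rewrite -[p]loc_pi_repr loc_addE.
by apply: loc_pi_eq; rewrite /= scaler0 add0r scale1r mul1r.
Qed.

Fact loc_addN : left_inverse (loc_pi (0, den_one)) loc_opp loc_add.
Proof.
move=> p; rewrite -[p]loc_pi_repr loc_oppE loc_addE.
by apply: loc_pi_eq; rewrite /= scalerN addNr !scaler0.
Qed.

HB.instance Definition _ :=
  GRing.isZmodule.Build loc loc_addA loc_addC loc_add0 loc_addN.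

Fact loc_scaleA a b p : loc_scale a (loc_scale b p) = loc_scale (a * b) p.
Proof.
rewrite -[p]loc_pi_repr !loc_scaleE; congr loc_pi.
by rewrite /frac_scale /= scalerA.
Qed.

Fact loc_scale1 : left_id 1 loc_scale.
Proof.
move=> p; rewrite -[p]loc_pi_repr loc_scaleE; apply: loc_pi_eq.
by rewrite /= scale1r.
Qed.

Fact loc_scaleDr : right_distributive loc_scale +%R.
Proof.
move=> a p q; rewrite -[p]loc_pi_repr -[q]loc_pi_repr.
rewrite [X in loc_scale a X]loc_addE !loc_scaleE [RHS]loc_addE.
apply: loc_pi_eq; rewrite /= !scalerDr !scalerA.
by congr (_ *: _ + _ *: _); ring.
Qed.

Fact loc_scaleDl p : {morph loc_scale^~ p : a b / a + b}.
Proof.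
move=> a b; rewrite -[p]loc_pi_repr !loc_scaleE [RHS]loc_addE.
apply: loc_pi_eq; rewrite /= !scalerA -scalerDl scalerA.
by congr (_ *: _); ring.
Qed.

HB.instance Definition _ := GRing.Zmodule_isLmodule.Build R loc
  loc_scaleA loc_scale1 loc_scaleDr loc_scaleDl.

End Localization.

Section LocalizationMap.
Variables (R : comNzRingType) (S : mulrClosed R) (M N : lmodType R).

Definition loc_map (f : M -> N) (p : loc S M) : loc S N :=
  loc_pi (f (repr p).1, (repr p).2).

Variable f : {linear M -> N}.

Lemma loc_mapE x : loc_map f (loc_pi x) = loc_pi (f x.1, x.2).
Proof.
rewrite /loc_map; set x' := repr (loc_pi x).
have /loc_piP[u uS ex] : loc_pi x' = loc_pi x by exact: loc_pi_repr.
by apply/loc_piP; exists u; rewrite //= -!linearZ ex.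
Qed.

Fact loc_map_is_linear : linear (loc_map f).
Proof.
move=> a p q; rewrite -[p]loc_pi_repr -[q]loc_pi_repr.
rewrite [a *: _]loc_scaleE [X in loc_map f X]loc_addE !loc_mapE.
rewrite [a *: _]loc_scaleE [RHS]loc_addE; congr loc_pi.
have fZ b m : f (b *: m) = b *: f m by exact: linearZ_LR.
by rewrite /frac_add /= linearD !fZ.
Qed.

HB.instance Definition _ := GRing.isLinear.Build R (loc S M) (loc S N) *:%R
  (loc_map f) loc_map_is_linear.

End LocalizationMap.

(* V seen as an R-module (algebra) through R -> {fraction R}. *)
Definition restr (R : idomainType) (V : Type) : Type := V.

Section RestrictionOfScalars.
Variable R : idomainType.
Local Notation K := {fraction R}.

HB.instance Definition _ (V : zmodType) := GRing.Zmodule.on (restr R V).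
HB.instance Definition _ (T : nzRingType) := GRing.NzRing.on (restr R T).

Section Module.
Variable V : lmodType K.
Definition restr_scale (a : R) (v : restr R V) : restr R V :=
  (FracField.tofrac a : K) *: (v : V).

Fact restr_scaleA a b v : restr_scale a (restr_scale b v) = restr_scale (a * b) v.
Proof. by rewrite /restr_scale tofracM scalerA. Qed.
Fact restr_scale1 : left_id 1 restr_scale.
Proof. by move=> v; rewrite /restr_scale tofrac1 scale1r. Qed.
Fact restr_scaleDr : right_distributive restr_scale +%R.
Proof. by move=> a u v; apply: scalerDr. Qed.
Fact restr_scaleDl v : {morph restr_scale^~ v : a b / a + b}.
Proof. by move=> a b; rewrite /restr_scale tofracD scalerDl. Qed.

HB.instance Definition _ := GRing.Zmodule_isLmodule.Build R (restr R V)
  restr_scaleA restr_scale1 restr_scaleDr restr_scaleDl.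
End Module.

Section Algebra.
Variable T : algType K.
Fact restr_scaleAl (a : R) (u v : restr R T) : a *: (u * v) = a *: u * v.
Proof. exact: scalerAl. Qed.
Fact restr_scaleAr (a : R) (u v : restr R T) : a *: (u * v) = u * (a *: v).
Proof. exact: scalerAr. Qed.
HB.instance Definition _ := GRing.Lmodule_isLalgebra.Build R (restr R T)
  restr_scaleAl.
HB.instance Definition _ := GRing.Lalgebra_isAlgebra.Build R (restr R T)
  restr_scaleAr.
End Algebra.

End RestrictionOfScalars.

Section CanonicalMap.
Variables (R : idomainType) (T S : algType {fraction R}).
Variables (A : subalgClosed (restr R T)) (B : subalgClosed (restr R S)).

Definition mu_bil (a : submod A) (b : submod B) : restr R (tens T S) :=
  tensor (val a : T) (val b : S).

Fact mu_is_bilinear : bilinear_for *:%R *:%R mu_bil.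
Proof.
split=> [b c a a' | a c b b']; rewrite /mu_bil linearP.
  exact: linearPl.
exact: linearPr.
Qed.

HB.instance Definition _ := bilinear_isBilinear.Build R (submod A) (submod B)
  (restr R (tens T S)) *:%R *:%R mu_bil mu_is_bilinear.

Definition mu : {linear tens (submod A) (submod B) -> restr R (tens T S)} :=
  tens_lift mu_bil.

Lemma muE (a : submod A) (b : submod B) :
  mu (tensor a b) = tensor (val a : T) (val b : S).
Proof. exact: tens_liftE. Qed.

End CanonicalMap.

Section InjectiveEnvelope.
Variable R : pzRingType.

Definition injective_module (E : lmodType R) :=
  forall (A B : lmodType R) (i : {linear A -> B}) (f : {linear A -> E}),
    injective i -> exists g : {linear B -> E}, forall a, g (i a) = f a.

(* Every nonzero submodule of E meets i(M) nontrivially. *)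
Definition essential_ext (M E : lmodType R) (i : {linear M -> E}) :=
  injective i /\
  forall S : submodClosed E, (exists2 x, x \in S & x != 0) ->
    exists m : M, i m \in S /\ i m != 0.

Definition injective_envelope (M E : lmodType R) (i : {linear M -> E}) :=
  injective_module E /\ essential_ext i.

End InjectiveEnvelope.

Section WTheory.
Variable R : idomainType.
Local Notation K := {fraction R}.
Local Notation ideal := (submodClosed R^o).
Local Notation "x %:F" := (FracField.tofrac x : K).

(* The image of r under the natural map R -> Hom_R(J, R). *)
Definition hom_mul (J : ideal) (r : R) : submod J -> R^o :=
  fun x => r * (val x : R).

(* The second condition says that r |-> hom_mul J r is bijective. *)
Definition GV (J : ideal) :=
  fin_gen J /\ forall f : {linear submod J -> R^o}, exists! r : R, f =1 hom_mul r.

Definition GV_torsion (M : lmodType R) :=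
  forall x : M, exists2 J : ideal, GV J & forall a : R, a \in J -> a *: x = 0.

Definition GV_torsion_free (M : lmodType R) :=
  forall (J : ideal) (x : M), GV J -> (forall a : R, a \in J -> a *: x = 0) ->
    x = 0.

Definition torsion_free (M : lmodType R) :=
  forall (a : R) (x : M), a *: x = 0 -> a = 0 \/ x = 0.

(* For M embedded in its injective envelope E, this is M_w. *)
Definition w_closure (E : lmodType R) (M : set E) : set E :=
  [set x | exists2 J : ideal, GV J & forall a : R, a \in J -> M (a *: x)].

Definition w_module (M : lmodType R) :=
  GV_torsion_free M /\
  exists (E : lmodType R) (i : {linear M -> E}),
    injective_envelope i /\ w_closure (range i) = range i.

Definition w_ideal (I : ideal) := w_module (submod I).

Definition w_max (m : ideal) :=
  [/\ w_ideal m, 1 \notin m &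
    forall I : ideal, w_ideal I -> 1 \notin I -> {subset m <= I} -> I =i m].

(* K is the injective envelope of every nonzero ideal of R, so the w-closure of
   I I^-1 is computed inside K. *)
Definition ideal_inv (I : ideal) : set K :=
  [set x | forall a : R, a \in I -> exists r : R, a%:F * x = r%:F].

Definition ideal_mul_inv (I : ideal) : {pred restr R K^o} :=
  spanm [set y : restr R K^o | exists (a : R) (x : K),
    [/\ a \in I, ideal_inv I x & y = a%:F * x]].

Definition w_invertible (I : ideal) :=
  w_closure [set x | x \in ideal_mul_inv I] =
  [set x : restr R K^o | exists r : R, x = r%:F].

Definition PvMD :=
  forall I : ideal, fin_gen I -> (exists2 a : R, a \in I & a != 0) ->
    w_invertible I.

Definition w_flat (F : lmodType R) := forall N : lmodType R, GV_torsion (Tor N F 1).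

Section PrimeLocalization.
Variable p : prime_idealr R.

Definition prime_ideal : {pred R^o} := fun x => x \in p.

Fact prime_ideal_closed : submod_closed prime_ideal.
Proof.
split; first exact: idealr0.
by move=> a x y xp yp; apply: rpredD => //; apply: idealMr.
Qed.

HB.instance Definition _ := GRing.isSubmodClosed.Build R R^o prime_ideal
  prime_ideal_closed.

Definition prime_compl : {pred R} := fun x => x \notin p.

Fact prime_compl_closed : GRing.mulr_closed prime_compl.
Proof.
split=> [|x y xp yp]; first by rewrite unfold_in /prime_compl idealr1.
by rewrite unfold_in /prime_compl (prime_idealrM p) negb_or; apply/andP.
Qed.

HB.instance Definition _ := GRing.isMulClosed.Build R prime_compl
  prime_compl_closed.

End PrimeLocalization.

(* Localization at p in w-Max(R).  As elements of w-Max(R) are prime, letting p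
   range over the primes of R in w-Max(R) covers all of w-Max(R). *)
Definition w_exact (A B C : lmodType R) (f : {linear A -> B}) (g : {linear B -> C}) :=
  forall p : prime_idealr R, w_max (prime_ideal p) ->
    forall y : loc (prime_compl p) B,
      loc_map g y = 0 <-> exists x : loc (prime_compl p) A, loc_map f x = y.

Definition w_injective (A B : lmodType R) (f : {linear A -> B}) :=
  forall p : prime_idealr R, w_max (prime_ideal p) ->
    injective (loc_map f : loc (prime_compl p) A -> loc (prime_compl p) B).

Definition w_surjective (A B : lmodType R) (f : {linear A -> B}) :=
  forall p : prime_idealr R, w_max (prime_ideal p) ->
    forall y : loc (prime_compl p) B, exists x : loc (prime_compl p) A,
      loc_map f x = y.

(* A finite sequence 0 -> F n -> ... -> F 0 -> M -> 0 is extended by F i = 0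
   for i > n. *)
Definition w_wgldim_le (n : nat) :=
  forall M : lmodType R,
    exists (F : nat -> lmodType R) (d : forall i, {linear F i.+1 -> F i})
      (e : {linear F 0 -> M}),
      [/\ forall i, w_flat (F i),
          forall i, (n < i)%N -> forall x : F i, x = 0,
          w_surjective e,
          w_exact (d 0) e &
          forall i, w_exact (d i.+1) (d i)].

End WTheory.

(* Main.v *)
(* Call an element GV-killed when a GV-ideal annihilates it, and say that R is
   w-comparable when, for all a and b, the ideal (a : b) + (b : a) contains a
   GV-ideal; this ideal is I I^-1 for I = (a, b), and the condition says that
   R_m is a valuation domain at every maximal w-ideal m.  Every statement is
   compared with w-comparability.
   A PvMD is clearly w-comparable.  If R is w-comparable, finitely many
   elements have, up to GV-ideals, one of them dividing all the others, which
   gives the w-invertibility of finitely generated ideals, and allows to shorten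
   a tensor sum_k b_k (x) a_k along any relation between the a_k in a torsion-free
   module; when no relation is left the tensor is zero as soon as its image in a
   free module (for Tor_1) or in T (x)_K S (for mu) is zero.
   Conversely, for I = (a, b), the tensor a (x) b - b (x) a of I (x) I vanishes in
   I, hence defines an element of Tor_2(R/I, R/I), and of the kernel of mu for an
   algebra of polynomials with linear coefficient in I; the class modulo
   (a : b) + (b : a) of the product of the coordinates on a and b detects it.
   Passing from localizations to GV-ideals uses that an ideal without GV-ideal is
   contained in a maximal w-ideal; w-closures of nonzero ideals are computed in K,
   which is injective because it is torsion-free and divisible. *)
Require Import Defs.
From HB Require Import structures.
From mathcomp Require Import all_boot all_algebra.
From mathcomp Require Import ring_quotient fraction.
From mathcomp Require Import finmap monalg ring.
From mathcomp Require Import boolp classical_sets.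

Set Implicit Arguments.
Unset Strict Implicit.
Unset Printing Implicit Defensive.

Import GRing.Theory.
Local Open Scope ring_scope.
Local Open Scope quotient_scope.
Local Open Scope classical_set_scope.


(** * Spans, free modules and GV-ideals *)

Section Packing.
Variable R : comNzRingType.

(** Supplies bundled linear maps inside proofs; the next two lemmas do the same for submodules and
    for maps out of a tensor product. *)
Lemma linear_pack (U V : lmodType R) (f : U -> V) : linear f ->
  exists g : {linear U -> V}, g =1 f.
Proof.
move=> lf; pose m := GRing.isLinear.Build R U V *:%R f lf.
by pose g : {linear U -> V} := HB.pack f m; exists g.
Qed.

Lemma submod_pack (V : lmodType R) (P : {pred V}) : submod_closed P ->
  exists S : submodClosed V, S =i P.
Proof.
move=> cP; pose m := GRing.isSubmodClosed.Build R V P cP.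
by pose S : submodClosed V := HB.pack P m; exists S.
Qed.

Lemma tens_ump (M N W : lmodType R) (b : M -> N -> W) :
  (forall n, linear (b^~ n)) -> (forall m, linear (b m)) ->
  exists L : {linear tens M N -> W}, forall m n, L (tensor m n) = b m n.
Proof.
move=> bl br.
have bb : bilinear_for *:%R *:%R b by split=> [n a x y|m a x y]; [exact: bl|exact: br].
pose m := bilinear_isBilinear.Build R M N W *:%R *:%R b bb.
pose B : {bilinear M -> N -> W} := HB.pack b m.
by exists (tens_lift B) => x y; exact: (tens_liftE B).
Qed.

Lemma spanm_incl (V : lmodType R) (X : set V) x : X x -> x \in spanm X.
Proof.
move=> Xx; apply/asboolP; exists [:: (1, x)]; last by rewrite big_seq1 scale1r.
by move=> p; rewrite inE => /eqP ->.
Qed.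

(** Induction on a span: a property stable under linear combinations is packed as [S] and checked on
    the generators. *)
Lemma spanm_min (V : lmodType R) (X : set V) (S : submodClosed V) :
  (forall x, X x -> x \in S) -> {subset spanm X <= S}.
Proof.
move=> XS _ /asboolP[s sX ->]; rewrite big_seq; apply: rpred_sum => p /sX pX.
by apply: rpredZ; apply: XS.
Qed.

Lemma free_elemE (X : choiceType) (g : free_mod R X) :
  g = \sum_(x <- msupp g) mcoeff x g *: free_gen R x.
Proof.
rewrite [LHS]monalgE; apply: eq_bigr => x _.
by apply/malgP => k; rewrite mcoeffZ !mcoeffU mulr_natr.
Qed.

Lemma free_ext (X : choiceType) (V : lmodType R) (f g : {linear free_mod R X -> V}) :
  (forall x, f (free_gen R x) = g (free_gen R x)) -> f =1 g.
Proof.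
move=> fg u; rewrite (free_elemE u) !linear_sum; apply: eq_bigr => x _.
by rewrite !linearZ fg.
Qed.

Lemma tens_elemE (M N : lmodType R) (z : tens M N) :
  exists s : seq (M * N), z = \sum_(p <- s) tensor p.1 p.2.
Proof.
rewrite -[z]quot_pi_repr; set g := repr z; rewrite (free_elemE g) linear_sum.
elim: (enum_fset _) => [|p s [t IH]]; first by exists [::]; rewrite !big_nil.
exists ((mcoeff p g *: p.1, p.2) :: t); rewrite !big_cons IH; congr (_ + _).
by rewrite linearZ /= linearZl_LR; case: p.
Qed.

Lemma tens_ext (M N W : lmodType R) (f g : {linear tens M N -> W}) :
  (forall m n, f (tensor m n) = g (tensor m n)) -> f =1 g.
Proof.
move=> fg z; have [s ->] := tens_elemE z; rewrite !linear_sum.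
by apply: eq_bigr.
Qed.

End Packing.

(** * GV-ideals and the elements they kill *)

Section GV.
Variable R : idomainType.
Local Notation ideal := (submodClosed R^o).

Definition divides (a b : R) := exists c, b = a * c.

Lemma dividesMr a b c : divides a b -> divides a (b * c).
Proof. by case=> d ->; exists (d * c); rewrite mulrA. Qed.

Lemma dividesD a b c : divides a b -> divides a c -> divides a (b + c).
Proof. by case=> x -> [y ->]; exists (x + y); rewrite mulrDr. Qed.

(* The finite sequences generating a GV-ideal: since K is the field of
   fractions, J^-1 = R says that a divides b as soon as a divides b J. *)
Definition GVseq (s : seq R) :=
  (exists2 j, j \in s & j != 0) /\
  forall a b, a != 0 -> (forall j, j \in s -> divides a (b * j)) -> divides a b.

Definition GV_killed (M : lmodType R) (x : M) :=
  exists2 s, GVseq s & forall j, j \in s -> j *: x = 0.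

Lemma GVseq1 : GVseq [:: 1].
Proof.
split; first by exists 1; rewrite ?inE ?oner_neq0.
by move=> a b _ /(_ 1); rewrite inE eqxx mulr1; apply.
Qed.

Lemma GVseqM s t : GVseq s -> GVseq t -> GVseq [seq x * y | x <- s, y <- t].
Proof.
move=> [[x xs x0] hs] [[y yt y0] ht]; split.
  by exists (x * y); rewrite ?mulf_neq0 //; apply: allpairs_f.
move=> a b a0 h; apply: hs => // j js; apply: ht => // k kt.
by rewrite -mulrA; apply: h; apply: allpairs_f.
Qed.

(** By linearity [x * f y = y * f x], so [f] is multiplication by the single fraction [f a / a],
    which the divisibility property of [GVseq] puts in R. *)
Lemma GVseq_spanm (s : seq R) (J : ideal) : GVseq s ->
  J =i spanm [set x : R^o | x \in s] -> GV J.
Proof.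
move=> [[a as_ a0] hs] JE; split; first by exists s.
have aJ x : x \in s -> x \in J by move=> xs; rewrite JE; apply: spanm_incl.
move=> f; pose F (x : R) (xJ : x \in J) : R := f (Submod xJ).
have FE x y (xJ : x \in J) (yJ : y \in J) : x * F y yJ = y * F x xJ.
  have -> : x * F y yJ = f (x *: Submod yJ) by rewrite linearZ.
  have -> : y * F x xJ = f (y *: Submod xJ) by rewrite linearZ.
  by congr (f _); apply: val_inj; apply: mulrC.
have [r rE] : divides a (F a (aJ a as_)).
  apply: hs => // j js; exists (F j (aJ j js)).
  by rewrite mulrC; apply: FE.
exists r; split.
  move=> x; apply: (mulfI a0); rewrite /hom_mul.
  have := FE _ _ (aJ a as_) (valP x); rewrite /F.
  have -> : Submod (valP x) = x by apply: val_inj.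
  by rewrite -/(F _ _) rE => ->; ring.
move=> r' h; apply: (mulIf a0); have := h (Submod (aJ a as_)).
by rewrite -/(F a _) rE /hom_mul /= => <-; rewrite mulrC.
Qed.

(** If [x] divides [b * j] for all [j] in J, multiplication by [b / x] maps J to R, hence is given
    by an element of R. The generators are not all zero, since otherwise 0 and 1 would represent the
    same map. *)
Lemma GV_GVseq (J : ideal) : GV J ->
  exists2 s : seq R, GVseq s & J =i spanm [set x : R^o | x \in s].
Proof.
move=> [[s JE] h]; exists s => //.
have sJ (x : R) : x \in s -> x \in J by move=> xs; rewrite JE; apply: spanm_incl.
have [a as_ a0] : exists2 j : R, j \in s & j != 0.
  apply: contrapT => hs.
  have s0 (j : R) : j \in J -> j = 0.
    have h0 : submod_closed (pred1 (0 : R^o)).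
      split; first by rewrite inE.
      by move=> c u v; rewrite !inE => /eqP-> /eqP->; rewrite scaler0 addr0.
    have [Z ZE] := submod_pack h0.
    rewrite JE => /(@spanm_min _ _ _ Z) jZ; apply/eqP.
    have := jZ; rewrite ZE inE; apply => x xs; rewrite ZE inE.
    by apply/eqP/eqP; apply: contrapT => /negP x0; apply: hs; exists x.
  have l0 : linear (fun _ : submod J => 0 : R^o).
    by move=> c x y; rewrite scaler0 addr0.
  have [g gE] := linear_pack l0; have [r [_ rU]] := h g.
  have gM c : g =1 @hom_mul _ J c.
    by move=> x; rewrite gE /hom_mul (s0 _ (valP x)) mulr0.
  by have /eqP := etrans (esym (rU 1 (gM 1))) (rU 0 (gM 0)); rewrite oner_eq0.
split; first by exists a.
move=> x b x0 hb.
have hb' (j : R) : j \in J -> divides x (b * j).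
  have cl : submod_closed (fun j : R^o => `[< divides x (b * (j : R)) >]).
    split; first by apply/asboolP; exists 0; rewrite !mulr0.
    move=> c u v /asboolP[u' uE] /asboolP[v' vE]; apply/asboolP.
    by exists (c * u' + v'); rewrite !mulrDr vE; congr (_ + _); rewrite mulrCA uE; ring.
  have [Z ZE] := submod_pack cl.
  rewrite JE => /(@spanm_min _ _ _ Z) jZ; apply/asboolP.
  have := jZ; rewrite ZE; apply => y ys; rewrite ZE.
  by apply/asboolP; apply: hb.
have [f fE] : exists f : submod J -> R, forall j : submod J, b * ((sub_val j : R^o) : R) = x * f j.
  have /choice[f fE] (j : submod J) : exists c, b * ((sub_val j : R^o) : R) = x * c.
    by apply: hb'; apply: valP.
  by exists f.
have [g gE] : exists g : {linear submod J -> R^o}, g =1 f.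
  apply: linear_pack => c u v; apply: (mulfI x0).
  pose p (w : submod J) : R := sub_val w.
  have {}fE w : b * p w = x * f w by exact: fE.
  change (x * f (c *: u + v) = x * (c * f u + f v)).
  rewrite mulrDr [x * (c * _)]mulrCA -!fE.
  by change (b * (c * p u + p v) = c * (b * p u) + b * p v); ring.
have [r [hr _]] := h g.
exists r; apply: (mulIf a0).
by rewrite (fE (Submod (sJ a as_))) -gE hr /hom_mul /= mulrA.
Qed.

Lemma GV_killedP (M : lmodType R) (x : M) :
  (exists2 J : ideal, GV J & forall a : R, a \in J -> a *: x = 0) <-> GV_killed x.
Proof.
split=> [[J /GV_GVseq[s sG JE] h]|[s sG h]].
  by exists s => // j js; apply: h; rewrite JE; apply: spanm_incl.
have cl : submod_closed (fun a : R^o => (a : R) *: x == 0).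
  split; first by rewrite unfold_in scale0r.
  move=> c u v /eqP hu /eqP hv; apply/eqP.
  by rewrite scalerDl -[c *: u]/(c * u) -scalerA hu hv scaler0 addr0.
have [Z ZE] := submod_pack cl.
have [J JE] := submod_pack (spanm_submod_closed [set a : R^o | a \in s]).
exists J; first exact: GVseq_spanm sG JE.
move=> a; rewrite JE => /(@spanm_min _ _ _ Z) aZ.
by apply/eqP; have := aZ; rewrite ZE; apply => y ys; rewrite ZE; apply/eqP/h.
Qed.

Lemma GV_torsionP (M : lmodType R) : GV_torsion M <-> forall x : M, GV_killed x.
Proof. by split=> h x; apply/GV_killedP; apply: h. Qed.

Section Killed.
Variable M : lmodType R.
Implicit Types x y : M.

Lemma GV_killed0 : GV_killed (0 : M).
Proof. by exists [:: 1]; [exact: GVseq1 | move=> j _; rewrite scaler0]. Qed.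

Lemma GV_killedD x y : GV_killed x -> GV_killed y -> GV_killed (x + y).
Proof.
move=> [s sG hs] [t tG ht]; exists [seq j * k | j <- s, k <- t]; first exact: GVseqM.
move=> _ /allpairsP[[j k] /= [js kt ->]].
rewrite scalerDr -[in _ *: y]scalerA ht // scaler0 addr0.
by rewrite mulrC -scalerA hs // scaler0.
Qed.

Lemma GV_killed_sum (I : Type) (r : seq I) (F : I -> M) :
  (forall i, GV_killed (F i)) -> GV_killed (\sum_(i <- r) F i).
Proof.
by move=> hF; elim/big_rec: _ => [|i x _]; [exact: GV_killed0|apply: GV_killedD].
Qed.

(** One product of GV-ideals kills all the finitely many [j *: x]; its product with [s] kills
    [x]. *)
Lemma GV_killed_trans s x : GVseq s ->
  (forall j, j \in s -> GV_killed (j *: x)) -> GV_killed x.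
Proof.
move=> sG h.
have [t tG ht] : exists2 t, GVseq t &
    forall j k, j \in s -> k \in t -> k *: (j *: x) = 0.
  elim: s h {sG} => [_|j s IH h]; first by exists [:: 1] => //; exact: GVseq1.
  have [t tG ht] := IH (fun k ks => h k (mem_behead (s := j :: s) ks)).
  have [u uG hu] := h j (mem_head _ _).
  exists [seq a * b | a <- t, b <- u]; first exact: GVseqM.
  move=> k _ kjs /allpairsP[[a b] /= [at_ bu ->]].
  move: kjs; rewrite inE => /orP[/eqP->|ks]; first by rewrite -scalerA hu ?scaler0.
  by rewrite mulrC -scalerA ht ?scaler0.
exists [seq a * b | a <- t, b <- s]; first exact: GVseqM.
by move=> _ /allpairsP[[k j] /= [kt js ->]]; rewrite -scalerA ht.
Qed.

End Killed.

Lemma GV_killed_linear (M N : lmodType R) (f : {linear M -> N}) x :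
  GV_killed x -> GV_killed (f x).
Proof.
by move=> [s sG h]; exists s => // j js; rewrite -linearZ h ?linear0.
Qed.

Lemma GV_killed_quot (M : lmodType R) (S : submodClosed M) x :
  GV_killed (quot_pi S x) <-> exists2 s, GVseq s & forall j, j \in s -> j *: x \in S.
Proof.
have piE y : quot_pi S y = 0 <-> y \in S.
  by rewrite -(linear0 (quot_pi S)) quot_piP subr0.
split=> -[s sG h]; exists s => // j /h.
  by rewrite -linearZ => /piE.
by rewrite -linearZ => jx; apply/piE.
Qed.

End GV.


(** * w-comparability and PvMDs *)

Section Comparability.
Variable R : idomainType.
Local Notation K := {fraction R}.
Local Notation ideal := (submodClosed R^o).
Local Notation "x %:F" := (FracField.tofrac x : K).

Lemma tofrac_inj : injective (fun x : R => x%:F).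
Proof. by move=> x y /eqP; rewrite tofrac_eq => /eqP. Qed.

Lemma fracE (x : K) : exists n d : R, d != 0 /\ x = n%:F / d%:F.
Proof.
elim/quotW: x => -[[n d] /= d0]; exists n, d; split=> //.
apply: (canRL (mulfK _)); first by rewrite tofrac_eq0.
change (FracField.mul (\pi_(FracField.type R) (@mkRatio R (n, d) d0)) d%:F = n%:F).
rewrite !piE; apply/eqmodP; rewrite /= FracField.equivfE /FracField.mulf.
by rewrite !numden_Ratio ?mulr1 ?oner_neq0 //= mulrC.
Qed.

(** This is J^-1 = R inside K, deduced from divisibility in R by clearing the denominator of [x]. *)
Lemma GVseq_frac (s : seq R) (x : K) : GVseq s ->
  (forall j, j \in s -> exists r : R, j%:F * x = r%:F) -> exists r : R, x = r%:F.
Proof.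
move=> [_ hs]; have [n [d [d0 ->]]] := fracE x => h.
have d0F : d%:F != 0 by rewrite tofrac_eq0.
have [j js|r ->] := hs d n d0.
  have [r rE] := h j js; exists r; apply: tofrac_inj.
  by rewrite !tofracM -rE mulrCA [d%:F * _]mulrC divfK // mulrC.
by exists r; rewrite tofracM mulrAC divff // mul1r.
Qed.

(* At a maximal w-ideal m, one of the two summands of some j outside m is a
   unit, so R_m is a valuation domain. *)
Definition comparable_w :=
  forall a b : R, exists2 s, GVseq s &
    forall j, j \in s -> exists x y, [/\ j = x + y, divides a (x * b) & divides b (y * a)].

(** Induction on [s]: let [p] divide [t] times every element of the tail, and let [q] be the new
    element. Comparing [p] and [q] splits each [j] of a GV-ideal as [x + y], where [p] is a pivot
    for [x * t] and [q] is one for [y * t]. Locally this selects an element of least valuation. *)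
Lemma comparable_w_pivot : comparable_w ->
  forall (M : lmodType R) (s : seq R) (z : M), s != [::] ->
  (forall t, (exists2 p, p \in s & forall q, q \in s -> divides p (t * q)) ->
     GV_killed (t *: z)) ->
  GV_killed z.
Proof.
move=> cR M; elim=> [//|q [|r s] IH] z _ h.
  rewrite -[z]scale1r; apply: h; exists q; first exact: mem_head.
  by move=> q'; rewrite inE => /eqP->; exists 1; rewrite mulrC.
apply: IH => // t [p ps hp]; have [u uG hu] := cR p q.
apply: (GV_killed_trans uG) => j /hu[x [y [-> hx hy]]].
rewrite scalerDl !scalerA; apply: GV_killedD; apply: h.
  exists p => [|l]; first by rewrite inE ps orbT.
  rewrite inE => /orP[/eqP->|ls]; first by rewrite mulrAC; apply: dividesMr.
  by rewrite -mulrA mulrC; apply: dividesMr; apply: hp.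
exists q => [|l]; first exact: mem_head.
rewrite inE => /orP[/eqP->|ls]; first by rewrite mulrC; exists (y * t).
have [c cE] := hp l ls; rewrite -mulrA cE mulrA; exact: dividesMr.
Qed.

(* (a : b) + (b : a), which equals I I^-1 for I = (a, b) *)
Lemma colon_sum (a b : R) : exists N : submodClosed R^o,
  [/\ forall r : R, r \in N <-> exists x y, [/\ r = x + y, divides a (x * b) & divides b (y * a)] &
    forall c d : R, c * a + d * b = 0 -> c \in N /\ d \in N].
Proof.
have cl : submod_closed (fun r : R^o =>
    `[< exists x y : R, [/\ (r : R) = x + y, divides a (x * b) & divides b (y * a)] >]).
  split.
    apply/asboolP; exists 0, 0; rewrite addr0.
    by split=> //; rewrite mul0r; exists 0; rewrite mulr0.
  move=> c r r' /asboolP[x [y [-> hx hy]]] /asboolP[x' [y' [-> hx' hy']]].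
  apply/asboolP; exists (c * x + x'), (c * y + y'); split.
  - by change (c * (x + y) + (x' + y') = c * x + x' + (c * y + y')); ring.
  - by rewrite mulrDl -mulrA [c * _]mulrC; apply: dividesD => //; apply: dividesMr.
  - by rewrite mulrDl -mulrA [c * _]mulrC; apply: dividesD => //; apply: dividesMr.
have [N NE] := submod_pack cl.
have NP (r : R) : r \in N <-> exists x y, [/\ r = x + y, divides a (x * b) & divides b (y * a)].
  by rewrite NE; split=> [/asboolP|h]; last exact/asboolP.
have d0 (x : R) : divides x 0 by exists 0; rewrite mulr0.
exists N; split=> // c d /eqP; rewrite addr_eq0 => /eqP e; split; apply/NP.
  by exists 0, c; rewrite add0r mul0r e; split=> //; exists (- d); rewrite mulrN [b * d]mulrC.
exists d, 0; rewrite addr0 mul0r; split=> //; exists (- c).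
by rewrite mulrN [a * c]mulrC e opprK.
Qed.

(** Invertibility of I = (a, b) puts a GV-ideal in I I^-1. For [x] in I^-1 with [r = x * a] and
    [r' = x * b] one has [r * b = a * r'], so the product [(u * a + v * b) * x = u * r + v * r']
    splits as required. *)
Lemma PvMD_comparable : PvMD R -> comparable_w.
Proof.
move=> hR a b.
have [/eqP a0|a0] := boolP (a == 0).
  exists [:: 1]; first exact: GVseq1.
  move=> j; rewrite inE a0 => /eqP->; exists 0, 1.
  by split; [rewrite add0r|exists 0; rewrite !mul0r|exists 0; rewrite !mulr0].
have [I IE] := submod_pack
  (spanm_submod_closed [set x : R^o | x \in [:: a : R^o; b]]).
have aI : a \in I by rewrite IE; apply: spanm_incl; rewrite /= !inE eqxx.
have bI : b \in I by rewrite IE; apply: spanm_incl; rewrite /= !inE eqxx orbT.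
have Iab (i : R) : i \in I -> exists u v, i = u * a + v * b.
  have cl : submod_closed (fun i : R^o => `[< exists u v : R, (i : R) = u * a + v * b >]).
    split; first by apply/asboolP; exists 0, 0; rewrite !mul0r addr0.
    move=> c i1 i2 /asboolP[u [v iE]] /asboolP[u' [v' i'E]]; apply/asboolP.
    exists (c * u + u'), (c * v + v').
    by change (c * i1 + i2 = (c * u + u') * a + (c * v + v') * b); rewrite iE i'E; ring.
  have [Z ZE] := submod_pack cl.
  rewrite IE => /(@spanm_min _ _ _ Z) iZ; apply/asboolP; move: iZ; rewrite ZE; apply.
  move=> x; rewrite /= !inE ZE => /orP[]/eqP->; apply/asboolP.
    by exists 1, 0; rewrite mul1r mul0r addr0.
  by exists 0, 1; rewrite mul1r mul0r add0r.
have hI : w_closure [set x | x \in ideal_mul_inv I] =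
    [set x : restr R K^o | exists r : R, x = r%:F].
  by apply: hR; [exists [:: a : R^o; b]|exists a].
have [J JG hJ] : w_closure [set x | x \in ideal_mul_inv I] (1 : restr R K^o).
  by rewrite hI; exists 1; rewrite tofrac1.
have [s sG JE] := GV_GVseq JG; exists s => // j js.
have {}hJ : (j%:F : restr R K^o) \in ideal_mul_inv I.
  have := hJ j; rewrite /= -[_ *: _]/(j%:F * 1) mulr1; apply.
  by rewrite JE; apply: spanm_incl.
have [N [NP _]] := colon_sum a b.
have cl : submod_closed (fun k : restr R K^o => `[< exists2 r : R, r \in N & k = r%:F >]).
  split; first by apply/asboolP; exists 0; rewrite ?tofrac0 //; exact: (rpred0 N).
  move=> c _ _ /asboolP[x xN ->] /asboolP[y yN ->]; apply/asboolP; exists (c * x + y).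
    by apply: (rpredD _ yN); exact: (@rpredZ _ _ N c x).
  by rewrite tofracD tofracM.
have [Z ZE] := submod_pack cl.
suff /asboolP[r rN /tofrac_inj ->] : `[< exists2 r : R, r \in N & j%:F = r%:F >] by apply/NP.
have := @spanm_min _ _ _ Z _ _ hJ; rewrite ZE; apply=> _ [i [x [iI xI ->]]]; rewrite ZE.
have [u [v ->]] := Iab _ iI; have [r rE] := xI a aI; have [r' r'E] := xI b bI.
have ab : r * b = a * r'.
  by apply: tofrac_inj; rewrite !tofracM -rE -r'E; ring.
apply/asboolP; exists (u * r + v * r'); last by rewrite !tofracD !tofracM -rE -r'E; ring.
apply/NP; exists (u * r), (v * r'); split=> //.
- by rewrite -mulrA ab mulrCA; exists (u * r').
- by rewrite -mulrA [r' * a]mulrC -ab; exists (v * r); ring.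
Qed.

(** The pivot argument kills the class of 1 in K / I I^-1: if [p] divides [t * q] for every
    generator [q], then [t / p] is in I^-1 and [t = p * (t / p)] is in I I^-1. *)
Lemma comparable_PvMD : comparable_w -> PvMD R.
Proof.
move=> cR I [s IE] [a aI a0].
have sI x : x \in s -> x \in I by move=> xs; rewrite IE; apply: spanm_incl.
have Imin (P : R -> Prop) : P 0 -> (forall c x y, P x -> P y -> P (c * x + y)) ->
    (forall x : R, x \in s -> P x) -> forall i : R, i \in I -> P i.
  move=> P0 PD Ps i; have cl : submod_closed (fun i : R^o => `[< P i >]).
    split; first exact/asboolP.
    by move=> c x y /asboolP Px /asboolP Py; apply/asboolP; apply: PD.
  have [Z ZE] := submod_pack cl.
  rewrite IE => /(@spanm_min _ _ _ Z) iZ; apply/asboolP; move: iZ; rewrite ZE; apply.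
  by move=> x xs; rewrite ZE; apply/asboolP; apply: Ps.
have [b bs b0] : exists2 b : R, b \in s & b != 0.
  apply: contrapT => h; move/eqP: a0; apply.
  apply: (Imin (fun a => a = 0)) aI => [//|c x y -> ->|x xs]; first by rewrite mulr0 addr0.
  by apply/eqP; apply: contrapT => /negP x0; apply: h; exists x.
have [N NE] := submod_pack (spanm_submod_closed [set y : restr R K^o |
    exists (a : R) (x : K), [/\ a \in I, ideal_inv I x & y = a%:F * x]]).
have NR (y : K) : (y : restr R K^o) \in N -> exists r : R, y = r%:F.
  have cl : submod_closed (fun k : restr R K^o => `[< exists r : R, k = r%:F >]).
    split; first by apply/asboolP; exists 0; rewrite tofrac0.
    move=> c _ _ /asboolP[x ->] /asboolP[x' ->]; apply/asboolP; exists (c * x + x').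
    by rewrite tofracD tofracM.
  have [Z ZE] := submod_pack cl.
  rewrite NE => /(@spanm_min _ _ _ Z) yZ; apply/asboolP; move: yZ; rewrite ZE; apply.
  move=> _ [i [x [iI xI ->]]]; rewrite ZE; apply/asboolP; exact: xI.
have /GV_killedP[J JG hJ] : GV_killed (quot_pi N 1).
  apply: (comparable_w_pivot cR (s := s)).
    by move: bs; case: (s).
  move=> t [p ps hp].
  suff tN : (t%:F : restr R K^o) \in N.
    have -> : t *: quot_pi N 1 = 0; last exact: GV_killed0.
    rewrite -linearZ -(linear0 (quot_pi N)); apply/quot_piP; rewrite subr0.
    by rewrite -[t *: 1]/(t%:F * 1) mulr1.
  have [p0|p0] := eqVneq (p : R) 0.
    have [c] := hp b bs; rewrite p0 mul0r => /eqP.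
    by rewrite mulf_eq0 (negbTE b0) orbF => /eqP->; rewrite tofrac0 rpred0.
  have p0F : p%:F != 0 by rewrite tofrac_eq0.
  rewrite NE; apply: spanm_incl; exists p, (t%:F / p%:F); split; first exact: sI.
    apply: Imin => [|c x y [r rE] [r' r'E]|q qs].
    - by exists 0; rewrite tofrac0 mul0r.
    - by exists (c * r + r'); rewrite !tofracD !tofracM mulrDl -mulrA rE r'E.
    have [c cE] := hp q qs; exists c; apply: (mulfI p0F).
    by rewrite -tofracM -cE tofracM mulrCA [p%:F * _]mulrC divfK // mulrC.
  by rewrite mulrC divfK.
apply/seteqP; split=> [x [J' J'G h]|_ [r ->]].
  have [t tG JE] := GV_GVseq J'G; apply: (GVseq_frac tG) => j jt.
  apply: NR; rewrite NE; apply: h; rewrite JE; exact: spanm_incl.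
exists J => // j /hJ; rewrite -linearZ -(linear0 (quot_pi N)) => /quot_piP.
rewrite subr0 -[j *: 1]/(j%:F * 1) mulr1 => jN.
suff : (j *: (r%:F : restr R K^o)) \in N by rewrite NE.
rewrite -[_ *: _]/(j%:F * r%:F) mulrC.
exact: (@rpredZ _ _ N r (j%:F : restr R K^o)).
Qed.

End Comparability.


(** * Injective modules *)

Lemma submod_zorn (R : comNzRingType) (V : lmodType R) (S0 : submodClosed V)
    (Q : set V -> Prop) :
  Q [set x | x \in S0] ->
  (forall F : set (set V), F !=set0 -> F `<=` Q -> total_on F subset ->
     Q (\bigcup_(X in F) X)) ->
  exists S : submodClosed V, [/\ {subset S0 <= S}, Q [set x | x \in S] &
    forall S' : submodClosed V, Q [set x | x \in S'] -> {subset S <= S'} ->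
      {subset S' <= S}].
Proof.
move=> Q0 QF.
pose P (X : set V) := X = set0 \/ (Q X /\ exists S : submodClosed V,
  {subset S0 <= S} /\ X = [set x | x \in S]).
have [|A [PA Amax]] := @Zorn_bigcup V P.
  move=> F FP Ftot.
  pose F' := F `&` [set X | X !=set0].
  have FF' : \bigcup_(X in F) X = \bigcup_(X in F') X.
    apply/seteqP; split=> x [X FX Xx]; last by exists X => //; case: FX.
    by exists X => //; split=> //; exists x.
  have F'P X : F' X -> Q X /\ exists S : submodClosed V,
      {subset S0 <= S} /\ X = [set x | x \in S].
    by move=> [/FP[->|//] [x]].
  have [[X FX]|F0] := pselect (F' !=set0); last first.
    left; rewrite FF'; apply/seteqP; split=> // x [X FX _].
    by apply: F0; exists X.
  right; rewrite FF'; split.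
    apply: QF; first by exists X.
      by move=> Y /F'P[].
    by move=> Y Z [FY _] [FZ _]; exact: Ftot.
  have cl : submod_closed (fun x : V => `[< (\bigcup_(X in F') X) x >]).
    split.
      apply/asboolP; exists X => //.
      by have [_ [S [_ ->]]] := F'P _ FX; exact: rpred0.
    move=> c u v /asboolP[Y FY Yu] /asboolP[Z FZ Zv]; apply/asboolP.
    have [YZ|ZY] := Ftot Y Z FY.1 FZ.1.
      exists Z => //; have [_ [S [_ ZE]]] := F'P _ FZ; move: Zv (YZ _ Yu).
      by rewrite ZE => /= Sv Su; apply: rpredD => //; apply: rpredZ.
    exists Y => //; have [_ [S [_ YE]]] := F'P _ FY; move: (ZY _ Zv) Yu.
    by rewrite YE => /= Sv Su; apply: rpredD => //; apply: rpredZ.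
  have [S SE] := submod_pack cl; exists S; split.
    move=> x xS0; rewrite SE; apply/asboolP; exists X => //.
    by have [_ [S' [S0S' ->]]] := F'P _ FX; exact: S0S'.
  by apply/seteqP; split=> x /=; rewrite SE; [move=> ?; apply/asboolP|move=> /asboolP].
have [QA [S [S0S AE]]] : Q A /\ exists S : submodClosed V,
    {subset S0 <= S} /\ A = [set x | x \in S].
  case: PA => [A0|//]; exfalso; apply: (Amax [set x | x \in S0]).
    by rewrite A0; split=> // /(_ 0); apply; exact: rpred0.
  by right; split=> //; exists S0; split.
rewrite AE in Amax QA; exists S; split=> // S' QS' SS' x xS'.
apply: contrapT => xS; apply: (Amax [set x | x \in S']).
  by split=> // /(_ x xS').
by right; split=> //; exists S'; split=> // y /S0S /SS'.
Qed.

(* A partial map extends to r b |-> y whenever it is defined at r b with value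
   r y, by divisibility; torsion-freeness makes this extension well defined. *)
Lemma divisible_injective (R : idomainType) (E : lmodType R) :
  torsion_free E -> (forall (a : R) (y : E), a != 0 -> exists z, y = a *: z) ->
  injective_module E.
Proof.
move=> tfE divE A B i f iI.
have lif : linear (fun a : A => (i a, f a) : (B * E)%type).
  by move=> c u v; rewrite !linearP.
have [g gE] := linear_pack lif.
have [S0 S0E] := submod_pack (im_submod_closed g).
(* The competing submodules of B x E contain the graph of [f] along [i]; the property says that they
   are single-valued. *)
have [||S [S0S QS Smax]] := @submod_zorn R (B * E)%type S0 (fun X => forall y, X (0, y) -> y = 0).
- move=> y /=; rewrite S0E => /asboolP[a]; rewrite gE => -[ia <-].
  by have -> : a = 0; rewrite ?linear0 //; apply: iI; rewrite ia linear0.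
- by move=> F F0 FQ _ y [X /FQ]; apply.
have Stot b : exists y, (b, y) \in S.
  (* [y0] is the value to be given at [b], compatible with every multiple [s *: b] already in the
     domain. *)
  have [y0 y0P] : exists y0, forall s z, (s *: b, z) \in S -> z = s *: y0.
    have [[[r z] /= [r0 rS]]|nr] := pselect (exists p : R * E, p.1 != 0 /\ (p.1 *: b, p.2) \in S).
      have [y0 zE] := divE r z r0; exists y0 => s w sS.
      have : (0, r *: w - s *: z) \in S.
        have -> : (0, r *: w - s *: z) = r *: (s *: b, w) - s *: (r *: b, z) :> (B * E)%type.
          by congr pair; rewrite /= !scalerA mulrC subrr.
        by rewrite -scaleN1r; apply: rpredD; rewrite ?rpredZ //; apply: rpredZ.
      move/QS/eqP; rewrite subr_eq0 zE !scalerA [s * r]mulrC -scalerA => /eqP e.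
      have /tfE[/eqP|/eqP] : r *: (w - s *: y0) = 0 by rewrite scalerBr scalerA e -scalerA subrr.
        by rewrite (negbTE r0).
      by rewrite subr_eq0 => /eqP.
    exists 0 => s z sS; rewrite scaler0; have [s0|s0] := eqVneq s 0.
      by apply: QS; move: sS; rewrite s0 scale0r.
    by case: nr; exists (s, z).
  have cl : submod_closed (fun p : (B * E)%type =>
      `[< exists s, (p.1 - s *: b, p.2 - s *: y0) \in S >]).
    split; first by apply/asboolP; exists 0; rewrite !scale0r !subr0; exact: rpred0.
    move=> c u v /asboolP[s hs] /asboolP[t ht]; apply/asboolP; exists (c * s + t).
    have -> : ((c *: u + v).1 - (c * s + t) *: b, (c *: u + v).2 - (c * s + t) *: y0) =
       c *: (u.1 - s *: b, u.2 - s *: y0) + (v.1 - t *: b, v.2 - t *: y0) :> (B * E)%type.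
      by congr pair; rewrite /= !scalerDl scalerBr scalerA opprD addrACA.
    by apply: rpredD => //; apply: rpredZ.
  have [S' S'E] := submod_pack cl.
  exists y0; apply: (Smax S').
  - move=> y /=; rewrite S'E => /asboolP[s /=]; rewrite sub0r -!scaleNr => ys.
    by have /eqP := y0P _ _ ys; rewrite -subr_eq0 addrK => /eqP.
  - move=> [x y] h; rewrite S'E; apply/asboolP; exists 0.
    by rewrite !scale0r !subr0.
  - by rewrite S'E; apply/asboolP; exists 1; rewrite /= !scale1r !subrr; exact: rpred0.
have /choice[h hS] := Stot.
have hU b y : (b, y) \in S -> y = h b.
  move=> byS; apply/eqP; rewrite -subr_eq0; apply/eqP; apply: QS => /=.
  have -> : (0, y - h b) = (b, y) - (b, h b) :> (B * E)%type by congr pair; rewrite subrr.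
  by rewrite -scaleN1r; apply: rpredD => //; apply: rpredZ.
have lh : linear h.
  move=> c u v; apply/esym/hU.
  have -> : (c *: u + v, c *: h u + h v) = c *: (u, h u) + (v, h v) :> (B * E)%type by [].
  by apply: rpredD => //; apply: rpredZ.
have [k kE] := linear_pack lh; exists k => a; rewrite kE.
by apply/esym/hU; apply: S0S; rewrite S0E; apply/asboolP; exists a; rewrite gE.
Qed.

Lemma frac_injective (R : idomainType) :
  injective_module (restr R {fraction R}^o).
Proof.
apply: divisible_injective => [a x|a y a0].
  move=> h; have /eqP : FracField.tofrac a * (x : {fraction R}) = 0 := h.
  by rewrite mulf_eq0 tofrac_eq0 => /orP[] /eqP; [left|right].
have aF : FracField.tofrac a != 0 :> {fraction R} by rewrite tofrac_eq0.
exists ((FracField.tofrac a)^-1 * (y : {fraction R})).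
by rewrite -[_ *: _]/(FracField.tofrac a * _) mulVKf.
Qed.

Lemma field_injective (F : fieldType) : injective_module (F^o : lmodType F).
Proof.
apply: divisible_injective => [a x|a y a0].
  move=> h; have /eqP : a * (x : F) = 0 := h.
  by rewrite mulf_eq0 => /orP[] /eqP; [left|right].
by exists (a^-1 * (y : F)); rewrite -[_ *: _]/(a * _) mulVKf.
Qed.


(** * Maximal w-ideals *)

Section LocalPrinciple.
Variable R : idomainType.
Local Notation K := {fraction R}.
Local Notation ideal := (submodClosed R^o).
Local Notation "x %:F" := (FracField.tofrac x : K).

(** If [s] lay in I, the embedding of I in its envelope would extend to a map [g] on R. Then [g 1],
    multiplied into I by a GV-ideal, would come from some [b] in I, and cancelling a nonzero element
    of [s] would give [b = 1]. *)
Lemma w_ideal_GVfree (I : ideal) (s : seq R) : w_ideal I -> 1 \notin I ->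
  GVseq s -> exists2 j : R, j \in s & j \notin I.
Proof.
move=> [_ [E [i [[Einj [iI _]] iw]]]] I1 sG; apply: contrapT => h.
have sI j : j \in s -> j \in I.
  by move=> js; apply: contrapT => /negP jI; apply: h; exists j.
have lv : linear (val : submod I -> R^o) by move=> c u v; rewrite linearP.
have [f fE] := linear_pack lv.
have fI : injective f by move=> u v; rewrite !fE => /val_inj.
have [g gE] := Einj _ _ f i fI.
have gM (x : submod I) : i x = (val x : R) *: g 1.
  by rewrite -gE fE -linearZ; congr (g _); rewrite -[_ *: _]/(_ * _) mulr1.
have [J JE] := submod_pack (spanm_submod_closed [set x : R^o | x \in s]).
have JI (a : R) : a \in J -> a \in I.
  by rewrite JE; apply: (spanm_min (S := I)) => x; exact: sI.
have : w_closure (range i) (g 1).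
  exists J; first exact: GVseq_spanm JE.
  by move=> a aJ; exists (Submod (JI a aJ)); rewrite // gM.
rewrite iw => -[b _ bE].
have [[j js j0] _] := sG.
have e : j * 1 = j * (val b : R).
  have := gM (Submod (sI j js)); rewrite -bE -linearZ => /iI /(congr1 val).
  by rewrite [RHS]linearZ mulr1.
by have := valP b; rewrite -(mulfI j0 e) (negbTE I1).
Qed.

(** The envelope is K when I is nonzero, and the zero module I itself otherwise. *)
Lemma GVclosed_w_ideal (I : ideal) :
  (forall (x : R) s, GVseq s -> (forall j, j \in s -> j * x \in I) -> x \in I) ->
  w_ideal I.
Proof.
move=> hI; split.
  move=> J x /GV_GVseq[s [[j js j0] _] JE] h; apply: val_inj.
  have /h/(congr1 val) e : j \in J by rewrite JE; apply: spanm_incl.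
  have /eqP : j * (val x : R) = 0 by exact: e.
  by rewrite mulf_eq0 (negbTE j0) => /eqP.
have [I0|/existsNP[a /not_implyP[aI /eqP a0]]] := pselect (forall a : R, a \in I -> a = 0).
  have s0 (x : submod I) : x = 0 by apply: val_inj; apply: I0; apply: valP.
  exists (submod I), (idfun : {linear submod I -> submod I}); split; last first.
    apply/seteqP; split=> x _; first by exists x.
    have [J JE] := submod_pack (spanm_submod_closed [set x : R^o | x \in [:: 1 : R^o]]).
    by exists J; [apply: GVseq_spanm JE; exact: GVseq1|move=> b _; exists (b *: x)].
  split; last by split=> // S [x _]; rewrite (s0 x) eqxx.
  by move=> A B i f iI; exists (\0 : {linear B -> submod I}) => b; rewrite [RHS]s0.
have li : linear (fun x : submod I => (val x : R)%:F : restr R K^o).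
  by move=> c u v; rewrite linearP -[c *: val u]/(c * (val u : R)) tofracD tofracM.
have [i iE] := linear_pack li; exists (restr R K^o), i; split.
  split; first exact: frac_injective.
  split; first by move=> u v; rewrite !iE => /tofrac_inj/val_inj.
  move=> S [x xS x0]; have [n [d [d0 xE]]] := fracE x.
  have n0 : n != 0.
    by apply: contraNneq x0 => n0; rewrite xE n0 tofrac0 mul0r.
  (* Essentiality: for [x = n / d] nonzero, [(a * d) *: x = n * a] is a nonzero element of I. *)
  have anI : n * a \in I by exact: (@rpredZ _ _ I n a).
  exists (Submod anI); rewrite iE /=; split; last by rewrite tofrac_eq0 mulf_neq0.
  have -> : (n * a)%:F = (a * d) *: x.
    rewrite -[_ *: _]/((a * d)%:F * (x : K)) xE !tofracM -mulrA [d%:F * _]mulrC.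
    by rewrite divfK ?tofrac_eq0 // mulrC.
  exact: rpredZ.
apply/seteqP; split=> [x [J /GV_GVseq[s sG JE] h]|_ [u _ <-]]; last first.
  have [J JE] := submod_pack (spanm_submod_closed [set x : R^o | x \in [:: 1 : R^o]]).
  exists J; first by apply: GVseq_spanm JE; exact: GVseq1.
  by move=> b _; exists (b *: u); rewrite // linearZ.
have {}h j : j \in s -> exists2 r : R, r \in I & j%:F * (x : K) = r%:F.
  move=> js; have [|u _ uE] := h j; first by rewrite JE; apply: spanm_incl.
  by exists (val u); [exact: valP|rewrite -[LHS]uE iE].
have [r xE] : exists r : R, (x : K) = r%:F.
  by apply: GVseq_frac sG _ => j /h[r _ rE]; exists r.
have rI : r \in I.
  apply: hI sG _ => j /h[r' r'I]; rewrite xE -tofracM => /tofrac_inj ->.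
  exact: r'I.
by exists (Submod rI); rewrite // iE xE.
Qed.

(* An ideal maximal among those containing no GV-ideal is prime and maximal
   among the proper w-ideals, because the GV-ideals are closed under products. *)
Lemma ideal_GV_or_w_max (D : ideal) :
  (exists2 s, GVseq s & forall j : R, j \in s -> j \in D) \/
  exists p : prime_idealr R, w_max (prime_ideal p) /\
    forall j : R, j \in D -> j \in p.
Proof.
have [hD|nD] := pselect (exists2 s, GVseq s & forall j : R, j \in s -> j \in D); [by left|right].
pose Q (X : set R^o) := forall s, GVseq s -> exists2 j : R, j \in s & ~ X j.
have [||m [Dm Qm mmax]] := @submod_zorn R R^o D Q.
- move=> s sG; apply: contrapT => h; apply: nD; exists s => // j js.
  by apply: contrapT => jD; apply: h; exists j.
- move=> F F0 FQ Ftot s sG; apply: contrapT => h.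
  have {h} sF j : j \in s -> (\bigcup_(X in F) X) j.
    by move=> js; apply: contrapT => jD; apply: h; exists j.
  have [X FX sX] : exists2 X, F X & forall j, j \in s -> X j.
    elim: s sF {sG} => [_|j s IH h]; first by have [X FX] := F0; exists X.
    have [|X FX sX] := IH; first by move=> k ks; apply: h; rewrite inE ks orbT.
    have [Y FY Yj] := h j (mem_head _ _).
    have [XY|YX] := Ftot X Y FX FY.
      by exists Y => // k; rewrite inE => /orP[/eqP->//|/sX/XY].
    by exists X => // k; rewrite inE => /orP[/eqP->|/sX//]; exact: YX.
  by have [j js] := FQ X FX s sG; apply; exact: sX.
(* By maximality of m, the ideal m + R x contains a GV-ideal. *)
have add (x : R) : x \notin m -> exists2 s, GVseq s &
    forall j, j \in s -> exists c : R, j - c * x \in m.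
  move=> xm; apply: contrapT => h.
  have cl : submod_closed (fun y : R^o => `[< exists c : R, (y : R) - c * x \in m >]).
    split; first by apply/asboolP; exists 0; rewrite mul0r subr0; exact: (rpred0 m).
    move=> c u v /asboolP[a ua] /asboolP[b vb]; apply/asboolP; exists (c * a + b).
    have -> : (c *: u + v : R) - (c * a + b) * x = c *: ((u : R) - a * x : R^o) + ((v : R) - b * x).
      by change (c * u + v - (c * a + b) * x = c * (u - a * x) + (v - b * x)); ring.
    by apply: rpredD => //; apply: rpredZ.
  have [S SE] := submod_pack cl.
  have : {subset S <= m}.
    apply: mmax; last by move=> y ym; rewrite SE; apply/asboolP; exists 0; rewrite mul0r subr0.
    move=> s sG; apply: contrapT => h'; apply: h; exists s => // j js.
    suff : j \in S by rewrite SE => /asboolP.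
    by apply: contrapT => jS; apply: h'; exists j.
  move=> Sm; move/negP: xm; apply; apply: Sm; rewrite SE.
  by apply/asboolP; exists 1; rewrite mul1r subrr; exact: (rpred0 m).
have m1 : 1 \notin m.
  by have [j] := Qm _ (GVseq1 R); rewrite inE => /eqP-> /negP.
have mM (a x : R) : x \in m -> a * x \in m by exact: (@rpredZ _ _ m a x).
(* If [x * y] were in m with neither factor in m, m would contain the product of GV-ideals taken in
   m + R x and m + R y. *)
have mP : prime_idealr_closed (fun x : R => x \in m).
  move=> x y xy; apply/orP; apply: contrapT => /not_orP[/negP xm /negP ym].
  have [s sG hs] := add x xm; have [t tG ht] := add y ym.
  have [_ /allpairsP[[j k] /= [/hs[c jc] /ht[d kd] ->]]] := Qm _ (GVseqM sG tG); apply.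
  have -> : j * k = k * (j - c * x) + (c * x) * (k - d * y) + (c * d) * (x * y) by ring.
  by apply: rpredD; [apply: rpredD|]; apply: mM.
have mI : idealr_closed (fun x : R => x \in m).
  split=> [||a u v um vm]; [exact: (rpred0 m)|exact: m1|].
  exact: (rpredD (mM a u um) vm).
pose i1 := isIdealr.Build R _ mI; pose i2 := isPrimeIdealrClosed.Build R _ mP.
pose p : prime_idealr R := HB.pack (fun x : R => x \in m) i1 i2.
have pE x : (x \in p) = (x \in m) by [].
exists p; split; last by move=> j /Dm.
split.
- apply: GVclosed_w_ideal => x s sG h; rewrite -[_ \in _]/(x \in m).
  apply: contrapT => /negP/add[t tG ht].
  have [_ /allpairsP[[j k] /= [js /ht[c kc] ->]]] := Qm _ (GVseqM sG tG); apply.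
  have -> : j * k = j * (k - c * x) + c * (j * x) by ring.
  by apply: rpredD; apply: mM => //; apply: h.
- exact: m1.
- move=> I wI I1 mI' x; apply/idP/idP => [|/mI'//].
  apply: (mmax I) => // s sG.
  by have [j js /negP jI] := w_ideal_GVfree wI I1 sG; exists j.
Qed.

Lemma w_max_GVfree (p : prime_idealr R) (s : seq R) : w_max (prime_ideal p) ->
  GVseq s -> exists2 j, j \in s & j \notin p.
Proof. by move=> [wp p1 _] /(w_ideal_GVfree wp p1)[j js jp]; exists j. Qed.

(** The annihilator of [x] lies in no maximal w-ideal, so it contains a GV-ideal. *)
Lemma GV_killed_local (M : lmodType R) (x : M) :
  (forall p : prime_idealr R, w_max (prime_ideal p) ->
     exists2 u, u \notin p & u *: x = 0) ->
  GV_killed x.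
Proof.
move=> h; have cl : submod_closed (fun a : R^o => (a : R) *: x == 0).
  split; first by rewrite unfold_in scale0r.
  move=> c u v /eqP hu /eqP hv; apply/eqP.
  by rewrite scalerDl -[c *: u]/(c * u) -scalerA hu hv scaler0 addr0.
have [D DE] := submod_pack cl.
have [[s sG sD]|[p [pm Dp]]] := ideal_GV_or_w_max D.
  by exists s => // j /sD; rewrite DE => /eqP.
have [u /negP up ux] := h p pm; case: up; apply: Dp; rewrite DE.
exact/eqP.
Qed.

Lemma GV_range_local (M N : lmodType R) (f : {linear M -> N}) (y : N) :
  (forall p : prime_idealr R, w_max (prime_ideal p) ->
     exists u x, u \notin p /\ u *: y = f x) ->
  exists2 s, GVseq s & forall j, j \in s -> exists x, j *: y = f x.
Proof.
move=> h; have [S SE] := submod_pack (im_submod_closed f).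
have [|s sG hs] := @GV_killed_local _ (quot_pi S y).
  move=> p /h[u [x [up ux]]]; exists u => //.
  rewrite -linearZ -(linear0 (quot_pi S)); apply/quot_piP; rewrite subr0 SE.
  by apply/asboolP; exists x.
exists s => // j /hs; rewrite -linearZ -(linear0 (quot_pi S)) => /quot_piP.
by rewrite subr0 SE => /asboolP[x xE]; exists x.
Qed.

End LocalPrinciple.


(** * Tensor products and Tor *)

Section TensorFree.
Variables (R : comNzRingType) (N : lmodType R).

Lemma tens_mapr_subproof (M N' : lmodType R) (g : {linear N -> N'}) :
  exists L : {linear tens M N -> tens M N'}, forall m n, L (tensor m n) = tensor m (g n).
Proof.
apply: tens_ump => [n c m m'|m c n n']; first exact: linearPl.
by rewrite linearP linearPr.
Qed.

(** A free module tensored with N is a direct sum of copies of N; [c x] is the projection on the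
    copy at [x]. *)
Lemma tens_coord (X : choiceType) :
  exists c : X -> {linear tens (free_mod R X) N -> N},
    (forall x g n, c x (tensor g n) = mcoeff x g *: n) /\
    forall z, exists d : {fset X}, z = \sum_(x <- d) tensor (free_gen R x) (c x z).
Proof.
have /choice[c cE] (x : X) : exists L : {linear tens (free_mod R X) N -> N},
    forall g n, L (tensor g n) = mcoeff x g *: n.
  apply: tens_ump => [n a g h|g a n n'].
    by rewrite mcoeffD mcoeffZ scalerDl scalerA.
  by rewrite scalerDr !scalerA mulrC.
exists c; split=> // z; have [s ->] := tens_elemE z.
(* Allowing all larger index sets lets the induction bring the supports of two terms to a common
   one. *)
suff [d dE] : exists d : {fset X}, forall d' : {fset X}, (d `<=` d')%fset ->
    \sum_(p <- s) tensor p.1 p.2 =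
    \sum_(x <- d') tensor (free_gen R x) (c x (\sum_(p <- s) tensor p.1 p.2)).
  by exists d; apply: dE.
elim: s => [|[g n] s [d IH]].
  exists fset0 => d' _; rewrite big_nil big1 // => x _.
  by rewrite linear0 linear0r.
exists (msupp g `|` d)%fset => d' /fsubUsetP[gd' dd'].
rewrite big_cons /= {1}(IH d' dd').
rewrite [RHS](eq_bigr (fun x => tensor (free_gen R x) (c x (tensor g n)) +
  tensor (free_gen R x) (c x (\sum_(p <- s) tensor p.1 p.2)))); last first.
  by move=> x _; rewrite linearD linearDr.
rewrite big_split; congr (_ + _).
rewrite {1}(free_elemE g) linear_sumlz.
transitivity (\sum_(x <- d') tensor (mcoeff x g *: free_gen R x) n).
  apply: big_fset_incl => // x _ /mcoeff_outdom ->.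
  by rewrite scale0r linear0l.
by apply: eq_bigr => x _; rewrite cE linearZl_LR linearZr_LR.
Qed.

Lemma tens_map_comp (M M' M'' : lmodType R) (f : {linear M -> M'})
    (g : {linear M' -> M''}) (h : {linear M -> M''}) z :
  (forall x, h x = g (f x)) -> tens_map N h z = tens_map N g (tens_map N f z).
Proof.
move=> hE; apply: (tens_ext (f := tens_map N h) (g := tens_map N g \o tens_map N f)) => m n.
by rewrite /= !tens_mapE hE.
Qed.

Section Cover.
Variables (V S : lmodType R) (i : {linear S -> free_mod R V}).

(** Says that S is the first syzygy of V, without identifying it with an actual kernel. *)
Definition is_syzygy :=
  injective i /\ forall g, free_cover V g = 0 <-> exists k, i k = g.

Lemma free_cover_gen (v : V) : free_cover V (free_gen R v) = v.
Proof. exact: free_lift_gen. Qed.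

Lemma tens_cover_surj z : exists y, tens_map N (free_cover V) y = z.
Proof.
have [s ->] := tens_elemE z; exists (\sum_(p <- s) tensor (free_gen R p.1) p.2).
rewrite linear_sum; apply: eq_bigr => p _.
by rewrite tens_mapE free_cover_gen.
Qed.

Hypothesis iP : is_syzygy.

(** Right exactness: sending v (x) n to the class of [v] (x) n gives a map from V (x) N to the
    cokernel, well defined since elements with the same image under the cover differ by a syzygy. It
    inverts the map induced by the cover. *)
Lemma tens_cover_exact z : tens_map N (free_cover V) z = 0 ->
  exists w, tens_map N i w = z.
Proof.
have [T TE] := submod_pack (im_submod_closed (tens_map N i)).
have piE (g h : free_mod R V) n : free_cover V g = free_cover V h ->
    quot_pi T (tensor g n) = quot_pi T (tensor h n).
  move=> gh; have [k kE] : exists k, i k = g - h.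
    by apply/iP.2; rewrite linearB gh subrr.
  apply/quot_piP; rewrite TE; apply/asboolP; exists (tensor k n).
  by rewrite tens_mapE kE linearBl.
have [L LE] : exists L : {linear tens V N -> quotm T},
    forall v n, L (tensor v n) = quot_pi T (tensor (free_gen R v) n).
  apply: tens_ump => [n c v v'|v c n n']; last by rewrite linearPr linearP.
  rewrite -linearP -linearPl; apply: piE.
  by rewrite linearP !free_cover_gen.
move=> z0; have : quot_pi T z = 0.
  rewrite -(linear0 L) -z0.
  apply: (tens_ext (f := quot_pi T) (g := L \o tens_map N (free_cover V))) => g n.
  by rewrite /= tens_mapE LE; apply: piE; rewrite free_cover_gen.
rewrite -(linear0 (quot_pi T)) => /quot_piP; rewrite subr0 TE.
by move/asboolP.
Qed.

End Cover.

Lemma tens_cover_res_exact (V S : lmodType R) (i : {linear S -> free_mod R V})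
    (d : {linear free_mod R S -> free_mod R V}) y :
  is_syzygy i -> (forall x, d x = i (free_cover S x)) ->
  tens_map N (free_cover V) y = 0 <-> exists w, tens_map N d w = y.
Proof.
move=> iP dE; have E w := tens_map_comp w dE.
split=> [/(tens_cover_exact iP)[w <-]|[w <-]].
  by have [w' <-] := tens_cover_surj w; exists w'.
rewrite E -(tens_map_comp (h := \0)) => [|x]; last by apply/esym/iP.2; exists x.
have [t ->] := tens_elemE (tens_map N (free_cover S) w).
rewrite linear_sum big1 // => p _.
by rewrite tens_mapE linear0l.
Qed.

End TensorFree.

Section Syzygies.
Variables (R : comNzRingType) (X : lmodType R).

Definition syz_val n : {linear syz X n.+1 -> res X n} :=
  (val : submod (ker (free_cover (syz X n))) -> free_mod R (syz X n)).

Lemma syz_val_syzygy n : is_syzygy (@syz_val n).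
Proof.
split; first exact: val_inj.
move=> g; split=> [/eqP g0|[k <-]]; last by apply/eqP; exact: (valP k).
by exists (Submod (g0 : g \in ker (free_cover (syz X n)))).
Qed.

Lemma res_diffE n x : @res_diff R X n x = syz_val n (free_cover (syz X n.+1) x).
Proof. by []. Qed.

End Syzygies.

(** * Tor in positive degree as a kernel, over w-comparable domains *)

Section TorOne.
Variables (R : idomainType).

(** As [e] presents S as the cokernel of [d2], it identifies the homology at P1 with the kernel of
    [i]. *)
Lemma GV_torsion_homology (P2 P1 P0 S : lmodType R) (d2 : {linear P2 -> P1})
    (e : {linear P1 -> S}) (i : {linear S -> P0}) (C B : submodClosed P1) :
  (forall y, y \in C <-> i (e y) = 0) -> (forall y, y \in B <-> exists w, d2 w = y) ->
  (forall z, exists y, e y = z) -> (forall y, e y = 0 <-> exists w, d2 w = y) ->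
  GV_torsion (quotm (preim_pred (val : submod C -> P1) B)) <->
  forall z, i z = 0 -> GV_killed z.
Proof.
move=> CP BP esurj eker.
have killedP (c : submod C) :
    GV_killed (quot_pi (preim_pred (val : submod C -> P1) B) c) <->
    GV_killed (e (val c)).
  rewrite GV_killed_quot; split=> -[s sG h]; exists s => // j /h.
    by move=> /BP/eker; rewrite !linearZ.
  by move=> h'; apply/BP/eker; rewrite !linearZ.
rewrite GV_torsionP; split=> [h z z0|h q].
  have [y yE] := esurj z; have yC : y \in C by apply/CP; rewrite yE.
  by rewrite -yE; apply/(killedP (Submod yC)); apply: h.
by rewrite -[q]quot_pi_repr; apply/killedP/h/CP/valP.
Qed.

(** Dimension shifting: Tor in degree [n.+1] is the kernel of the tensored inclusion of a syzygy in
    [res X n]. *)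
Lemma GV_torsion_Tor (X N : lmodType R) n :
  GV_torsion (Tor X N n.+1) <->
  forall z, tens_map N (syz_val X n) z = 0 -> GV_killed z.
Proof.
apply: (@GV_torsion_homology _ _ _ _ (tens_map N (@res_diff R X n.+1))
  (tens_map N (free_cover (syz X n.+1)))) => [y|y|z|y].
- rewrite -(tens_map_comp y (@res_diffE _ X n)).
  by split=> [/eqP|/eqP].
- by split=> [/asboolP|h]; last exact/asboolP.
- exact: tens_cover_surj.
- exact: (tens_cover_res_exact y (syz_val_syzygy X n.+1) (@res_diffE _ X n.+1)).
Qed.

(* Induction on the number of terms of a tensor: a nontrivial relation between
   the a k allows, after multiplication by a pivot, to eliminate one of them. *)
Lemma comparable_tens_ker (A B W : lmodType R) (H : {linear tens B A -> W}) :
  comparable_w R -> torsion_free A ->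
  (forall n (b : 'I_n -> B) (a : 'I_n -> A),
     (forall r : 'I_n -> R, \sum_k r k *: a k = 0 -> forall k, r k = 0) ->
     H (\sum_k tensor (b k) (a k)) = 0 -> forall k, b k = 0) ->
  forall z, H z = 0 -> GV_killed z.
Proof.
move=> cR tfA indH.
suff main n (b : 'I_n -> B) (a : 'I_n -> A) :
    H (\sum_k tensor (b k) (a k)) = 0 -> GV_killed (\sum_k tensor (b k) (a k)).
  move=> z; have [s ->] := tens_elemE z; rewrite (big_nth (0, 0)) big_mkord.
  exact: (main _ (fun k => (nth (0, 0) s k).1) (fun k => (nth (0, 0) s k).2)).
elim: n b a => [|n IH] b a; first by rewrite big_ord0 => _; exact: GV_killed0.
set z := \sum_k _ => Hz.
have [ind|] := pselect (forall r : 'I_n.+1 -> R, \sum_k r k *: a k = 0 -> forall k, r k = 0).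
  have b0 := indH _ b a ind Hz.
  by rewrite /z big1 => [|k _]; [exact: GV_killed0|rewrite b0 linear0l].
move=> /existsNP[r /not_implyP[ra /existsNP[k0 /eqP rk0]]].
apply: (comparable_w_pivot cR (s := [seq r k | k <- enum 'I_n.+1])).
  by rewrite -size_eq0 size_map size_enum_ord.
move=> t [_ /mapP[k _ ->] hk].
have /choice[c cE] l : exists c, t * r l = r k * c.
  by apply: hk; apply: map_f; rewrite mem_enum.
have [rk|rk] := eqVneq (r k) 0.
  have /eqP := cE k0; rewrite rk mul0r mulf_eq0 (negbTE rk0) orbF => /eqP->.
  by rewrite scale0r; exact: GV_killed0.
have ck : c k = t by apply: (mulfI rk); rewrite -cE mulrC.
(* Torsion-freeness allows the relation, once multiplied by [t], to be divided by [r k]; the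
   coefficient of [a k] becomes [t]. *)
have ca : \sum_l c l *: a l = 0.
  have /tfA[/eqP|//] : r k *: \sum_l c l *: a l = 0.
    transitivity (t *: \sum_l r l *: a l); last by rewrite ra scaler0.
    rewrite !scaler_sumr; apply: eq_bigr => l _.
    by rewrite !scalerA cE.
  by rewrite (negbTE rk).
(* The new relation expresses [t *: a k] by the other [a l], which removes one term. *)
have tz : t *: z = \sum_l tensor (t *: b (lift k l) - c (lift k l) *: b k) (a (lift k l)).
  rewrite /z scaler_sumr (bigD1_ord k) //= -linearZr_LR.
  have -> : t *: a k = - \sum_(l < n) c (lift k l) *: a (lift k l).
    by apply/eqP; move: ca; rewrite (bigD1_ord k) //= ck => /eqP; rewrite addr_eq0.
  rewrite linearNr linear_sumr addrC -sumrB; apply: eq_bigr => l _.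
  by rewrite linearBl !linearZl_LR linearZr_LR.
by rewrite tz; apply: IH; rewrite -tz linearZ_LR Hz scaler0.
Qed.

(** For independent [a k], each coordinate in the free module turns a vanishing tensor into a
    relation between the [a k], so every coordinate of [i (b k)] is zero. *)
Lemma comparable_syzygy_flat (X S A : lmodType R) (i : {linear S -> free_mod R X}) :
  comparable_w R -> torsion_free A -> injective i ->
  forall z, tens_map A i z = 0 -> GV_killed z.
Proof.
move=> cR tfA iI; apply: comparable_tens_ker => // n b a ind H0 k.
have [c [cE _]] := tens_coord A X.
apply: iI; rewrite linear0; apply/malgP => x; rewrite mcoeff0.
apply: (ind (fun k => mcoeff x (i (b k)))).
move: H0 => /(congr1 (c x)); rewrite (linear_sum (tens_map A i)) (linear_sum (c x)) linear0 => e.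
by rewrite -[RHS]e; apply: eq_bigr => l _; rewrite /= tens_mapE cE.
Qed.

End TorOne.


(** * The canonical map mu *)

(** The [k]-th coordinate of F^n extends along the embedding defined by the independent family, F
    being injective over itself. *)
Lemma dual_functional (F : fieldType) (V : lmodType F) n (v : 'I_n -> V) :
  (forall x : 'I_n -> F, \sum_l x l *: v l = 0 -> forall l, x l = 0) ->
  forall k, exists f : {linear V -> F^o}, forall l, f (v l) = (l == k)%:R.
Proof.
move=> ind k.
have li : linear (fun x : 'rV[F]_n => \sum_l x 0 l *: v l).
  move=> c x y; rewrite scaler_sumr -big_split; apply: eq_bigr => l _.
  by rewrite !mxE scalerDl scalerA.
have lf : linear (fun x : 'rV[F]_n => x 0 k : F^o) by move=> c x y; rewrite !mxE.
have [i iE] := linear_pack li; have [f fE] := linear_pack lf.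
have iI : injective i.
  move=> x y xy; apply/eqP; rewrite -subr_eq0; apply/eqP/rowP => l; rewrite [RHS]mxE.
  by apply: (ind (fun l => (x - y) 0 l)); rewrite -iE linearB xy subrr.
have [g gE] := field_injective f iI; exists g => l.
have <- : i (delta_mx 0 l) = v l.
  rewrite iE (bigD1 l) //= mxE !eqxx scale1r big1 ?addr0 // => j jl.
  by rewrite mxE (negbTE jl) andbF scale0r.
by rewrite gE fE mxE eqxx eq_sym.
Qed.

Lemma common_denominator (R : idomainType) n (x : 'I_n -> {fraction R}) :
  exists2 d : R, d != 0 & exists r : 'I_n -> R,
    forall l, FracField.tofrac d * x l = FracField.tofrac (r l).
Proof.
have /choice[p pE] l : exists p : R * R, p.2 != 0 /\
    x l = FracField.tofrac p.1 / FracField.tofrac p.2.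
  by have [m [d dE]] := fracE (x l); exists (m, d).
exists (\prod_l (p l).2); first by apply/prodf_neq0 => l _; case: (pE l).
exists (fun l => (p l).1 * \prod_(j | j != l) (p j).2) => l.
have [p0 ->] := pE l; rewrite (bigD1 l) //= !tofracM mulrAC; congr (_ * _).
by rewrite mulrC divfK ?tofrac_eq0.
Qed.

Lemma tensor_swap (R : comNzRingType) (M N : lmodType R) (x y : R) (m : M) (n : N) :
  tensor (x *: m) (y *: n) = tensor (y *: m) (x *: n).
Proof. by rewrite !linearZl_LR !linearZr_LR /= !scalerA mulrC. Qed.

Section Mu.
Variable R : idomainType.
Local Notation K := {fraction R}.
Local Notation "x %:F" := (FracField.tofrac x : K).

Lemma restr_torsion_free (V : lmodType K) (S : submodClosed (restr R V)) :
  torsion_free (submod S).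
Proof.
move=> a x /(congr1 val) e; have : a%:F *: (val x : V) = 0 by exact: e.
move/eqP; rewrite scaler_eq0 tofrac_eq0 => /orP[]/eqP e'; [by left|right].
exact: val_inj.
Qed.

Lemma GV_torsion_ker (M N : lmodType R) (f : {linear M -> N}) :
  GV_torsion (submod (ker f)) <-> forall z, f z = 0 -> GV_killed z.
Proof.
rewrite GV_torsionP; split=> [h z z0|h z].
  have zk : z \in ker f by apply/eqP.
  exact: (GV_killed_linear val (h (Submod zk))).
have [|s sG hs] := h (val z); first by apply/eqP; exact: (valP z).
by exists s => // j js; apply: val_inj; rewrite linearZ linear0; exact: hs.
Qed.

(** A kernel element vanishes in every localization, hence is GV-killed by the local criterion.
    Conversely a GV-ideal has an element outside each maximal w-ideal, so what it kills vanishes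
    locally. *)
Lemma w_injectiveP (M N : lmodType R) (f : {linear M -> N}) :
  w_injective f <-> forall z, f z = 0 -> GV_killed z.
Proof.
split=> [h z z0|h p pm x y xy].
  apply: GV_killed_local => p pm.
  have /(h p pm)/loc_piP[u uS] : loc_map f (loc_pi (z, den_one (prime_compl p))) =
      loc_map f (loc_pi (0, den_one (prime_compl p))).
    by rewrite !loc_mapE /= z0 linear0.
  by rewrite /= mulr1 scaler0 => uz; exists u.
move: xy; rewrite -[x]loc_pi_repr -[y]loc_pi_repr !loc_mapE => /loc_piP[u uS] /=.
move: (repr x) (repr y) => [m s] [m' s'] /= e.
have /h[t tG ht] : f ((u * sval s') *: m - (u * sval s) *: m') = 0.
  have fZ c w : f (c *: w) = c *: f w by exact: linearZ_LR.
  by apply/eqP; rewrite linearB !fZ subr_eq0; apply/eqP; exact: e.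
have [j jt jp] := w_max_GVfree pm tG.
apply/loc_piP; exists (j * u); first exact: (@rpredM _ (prime_compl p) j u).
by apply/eqP; rewrite /= -subr_eq0 -!mulrA -!(scalerA j) -scalerBr ht.
Qed.

Section Subalgebras.
Variables (T S : algType K).
Variables (A : subalgClosed (restr R T)) (B : subalgClosed (restr R S)).

(** Clearing denominators, a family independent over R is independent over K; a dual functional on
    the second factor then isolates each [a k]. *)
Lemma comparable_mu_killed : comparable_w R -> forall z, mu A B z = 0 -> GV_killed z.
Proof.
move=> cR; apply: comparable_tens_ker => //; first exact: restr_torsion_free.
move=> n a b ind H0 k.
have e : \sum_l tensor (val (a l) : T) (val (b l) : S) = 0.
  rewrite -[RHS]H0 (linear_sum (mu A B)); apply: eq_bigr => l _.
  by rewrite muE.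
have [|f fE] := @dual_functional K S n (fun l => val (b l) : S) _ k.
  move=> x x0; have [d d0 [r rE]] := common_denominator x.
  have r0 : \sum_l r l *: b l = 0.
    apply: val_inj; rewrite linear_sum linear0.
    transitivity (d%:F *: \sum_l x l *: (val (b l) : S)).
      rewrite scaler_sumr; apply: eq_bigr => l _.
      by rewrite scalerA rE linearZ.
    by rewrite x0 scaler0.
  move=> l; have /eqP := rE l; rewrite (ind _ r0) tofrac0 mulf_eq0 tofrac_eq0.
  by rewrite (negbTE d0) => /eqP.
have [L LE] : exists L : {linear tens T S -> T}, forall t s, L (tensor t s) = f s *: t.
  apply: tens_ump => [s c t t'|t c s s'].
    by rewrite scalerDr !scalerA mulrC.
  by rewrite linearP scalerDl scalerA.
apply: val_inj; move: e => /(congr1 L).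
rewrite linear_sum linear0 (bigD1 k) //= LE fE eqxx scale1r big1 ?addr0 // => l lk.
by rewrite LE fE (negbTE lk) scale0r.
Qed.

End Subalgebras.

(** * From the kernel of [mu] back to w-comparability *)

Lemma mu_commutator (T : algType K) (A : subalgClosed (restr R T)) (u v : submod A)
    (x y : K) (m : T) :
  (val u : T) = x *: m -> (val v : T) = y *: m ->
  mu A A (tensor u v - tensor v u) = 0.
Proof.
move=> uE vE.
have e : mu A A (tensor u v) = mu A A (tensor v u).
  apply: (etrans (muE u v)); apply: (etrans _ (esym (muE v u))).
  rewrite [X in tensor X]uE [X in tensor _ X]vE [X in _ = tensor X _]vE [X in _ = tensor _ X]uE.
  exact: (@tensor_swap K T T).
move: (mu A A) (tensor u v) (tensor v u) e => f p q e.
by rewrite linearB e subrr.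
Qed.

(** The coefficients [c p] and [d p] of [g p] on [a] and [b] are unique modulo N = (a : b) + (b :
    a). Hence [c p * d q] defines a linear map from M (x) M to R / N, which takes the commutator to
    1. *)
Lemma tensor_commutator_comparable (a b : R) (M : lmodType R) (g : {linear M -> R^o})
    (u v : M) :
  (forall p, exists c d : R, g p = c * a + d * b :> R) -> g u = a -> g v = b ->
  GV_killed (tensor u v - tensor v u) ->
  exists2 s, GVseq s &
    forall j, j \in s -> exists x y, [/\ j = x + y, divides a (x * b) & divides b (y * a)].
Proof.
move=> gI gu gv zK; have [N [NP Nrel]] := colon_sum a b.
have /choice[c /choice[d cdE]] := gI.
have uniq p (x y : R) : (g p : R) = x * a + y * b -> c p - x \in N /\ d p - y \in N.
  rewrite cdE => e; apply: Nrel.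
  by rewrite !mulrBl addrACA -opprD e subrr.
have lin r p q : c (r *: p + q) - (r * c p + c q) \in N /\
    d (r *: p + q) - (r * d p + d q) \in N.
  apply: uniq; rewrite linearP -[r *: g p]/(r * (g p : R)) !cdE.
  by ring.
have NM (x y : R) : y \in N -> x * y \in N by exact: (@rpredZ _ _ N x y).
have [L LE] : exists L : {linear tens (M) (M) -> quotm N},
    forall p q, L (tensor p q) = quot_pi N (c p * d q).
  apply: tens_ump => [q r p p'|p r q q'].
    rewrite -linearP; apply/quot_piP.
    change (c (r *: p + p') * d q - (r * (c p * d q) + c p' * d q) \in N).
    have -> : c (r *: p + p') * d q - (r * (c p * d q) + c p' * d q) =
        d q * (c (r *: p + p') - (r * c p + c p')) by ring.
    by apply: NM; case: (lin r p p').
  rewrite -linearP; apply/quot_piP.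
  change (c p * d (r *: q + q') - (r * (c p * d q) + c p * d q') \in N).
  have -> : c p * d (r *: q + q') - (r * (c p * d q) + c p * d q') =
      c p * (d (r *: q + q') - (r * d q + d q')) by ring.
  by apply: NM; case: (lin r q q').
have [cu du] : c u - 1 \in N /\ d u - 0 \in N.
  by apply: uniq; rewrite gu mul1r mul0r addr0.
have [cv dv] : c v - 0 \in N /\ d v - 1 \in N.
  by apply: uniq; rewrite gv mul1r mul0r add0r.
have := GV_killed_linear L zK.
have -> : L (tensor u v - tensor v u) = quot_pi N 1.
  rewrite linearB !LE -linearB; apply/quot_piP.
  have -> : c u * d v - c v * d u - 1 =
    d v * (c u - 1) + (d v - 1) - d u * (c v - 0) :> R by ring.
  rewrite -mulNr; apply: rpredD; last exact: NM.
  by apply: rpredD => //; exact: NM.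
move=> /GV_killed_quot[s sG hs]; exists s => // j /hs.
rewrite -[j *: 1]/(j * 1) mulr1; move/NP; exact.
Qed.

(** The linear coefficient of a product is [p_0 q_1 + p_1 q_0], which stays in (a, b); higher
    coefficients are arbitrary in K. *)
Lemma poly_subalg (a b : R) :
  exists A : subalgClosed (restr R {poly K}), forall p : {poly K},
    (p : restr R {poly K}) \in A <->
    (exists r : R, p`_0 = r%:F) /\ exists c d : R, p`_1 = (c * a + d * b)%:F.
Proof.
pose P : {pred restr R {poly K}} := fun p => `[< (exists r : R, (p : {poly K})`_0 = r%:F) /\
  exists c d : R, (p : {poly K})`_1 = (c * a + d * b)%:F >].
have Pcl : GRing.subalg_closed P.
  split.
  - apply/asboolP; split; first by exists 1; rewrite coef1 tofrac1.
    by exists 0, 0; rewrite coef1 !mul0r addr0 tofrac0.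
  - move=> r p q /asboolP[[p0 p0E] [c [d p1E]]] /asboolP[[q0 q0E] [c' [d' q1E]]].
    apply/asboolP; split.
      exists (r * p0 + q0); rewrite coefD -[r *: p]/(r%:F *: (p : {poly K})) coefZ.
      by rewrite p0E q0E tofracD tofracM.
    exists (r * c + c'), (r * d + d').
    rewrite coefD -[r *: p]/(r%:F *: (p : {poly K})) coefZ p1E q1E !(tofracD, tofracM).
    by ring.
  - move=> p q /asboolP[[p0 p0E] [c [d p1E]]] /asboolP[[q0 q0E] [c' [d' q1E]]].
    apply/asboolP; split.
      by exists (p0 * q0); rewrite coef0M p0E q0E tofracM.
    exists (p0 * c' + q0 * c), (p0 * d' + q0 * d).
    rewrite coefM !big_ord_recl big_ord0 /= p0E p1E q0E q1E !(tofracD, tofracM).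
    by ring.
pose m := GRing.isSubalgClosed.Build R (restr R {poly K}) P Pcl.
pose A : subalgClosed (restr R {poly K}) := HB.pack P m.
by exists A => p; split=> [/asboolP|?]; last exact/asboolP.
Qed.

(* With I = (a, b), the elements aX (x) bX and bX (x) aX of A (x) A have the
   same image, where A consists of the polynomials with constant term in R and
   linear coefficient in I. *)
Lemma mu_comparable :
  (forall (T S : algType K) (A : subalgClosed (restr R T)) (B : subalgClosed (restr R S)),
     forall z, mu A B z = 0 -> GV_killed z) ->
  comparable_w R.
Proof.
move=> h a b; have [A AP] := poly_subalg a b.
have /choice[g gE] (p : submod A) : exists r : R, (val p : {poly K})`_1 = r%:F.
  by have /AP[_ [c [d ->]]] := valP p; exists (c * a + d * b).
have gP r p q : g (r *: p + q) = r * g p + g q.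
  apply: tofrac_inj; rewrite -gE tofracD tofracM -!gE -coefZ -coefD.
  by congr (_`_1); exact: linearP.
have lg : linear (g : submod A -> R^o) by exact: gP.
have [G GE] := linear_pack lg.
have gI p : exists c d : R, G p = c * a + d * b :> R.
  have /AP[_ [c [d e]]] := valP p; exists c, d; rewrite GE.
  by apply: tofrac_inj; rewrite /= -gE.
have XA (x y z : R) : z = x * a + y * b -> (z%:F *: 'X : restr R {poly K}) \in A.
  move=> zE; apply/AP; split.
    by exists 0; rewrite coefZ coefX mulr0 tofrac0.
  by exists x, y; rewrite coefZ coefX mulr1 zE.
have aE : a = 1 * a + 0 * b by rewrite mul1r mul0r addr0.
have bE : b = 0 * a + 1 * b by rewrite mul1r mul0r add0r.
have gX x (xA : (x%:F *: 'X : restr R {poly K}) \in A) : G (Submod xA) = x.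
  by rewrite GE; have := gE (Submod xA); rewrite coefZ coefX mulr1 => /tofrac_inj/esym.
apply: (tensor_commutator_comparable gI (gX _ (XA _ _ _ aE)) (gX _ (XA _ _ _ bE))).
by apply: h; exact: (@mu_commutator _ A _ _ _ _ 'X).
Qed.

End Mu.


(** * Tor_2 and the w-weak global dimension *)

Section RightFunctoriality.
Variables (R : comNzRingType) (M N N' : lmodType R) (g : {linear N -> N'}).

Definition tens_mapr : {linear tens M N -> tens M N'} :=
  sval (cid (tens_mapr_subproof M g)).

Lemma tens_maprE m n : tens_mapr (tensor m n) = tensor m (g n).
Proof. by rewrite /tens_mapr; case: cid. Qed.

End RightFunctoriality.

Section TorTwo.
Variable R : idomainType.

Lemma tens_map_mapr (M M' N N' : lmodType R) (f : {linear M -> M'}) (g : {linear N -> N'}) z :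
  tens_map N' f (tens_mapr M g z) = tens_mapr M' g (tens_map N f z).
Proof.
apply: (tens_ext (f := tens_map N' f \o tens_mapr M g) (g := tens_mapr M' g \o tens_map N f)).
by move=> m n; rewrite /= tens_maprE !tens_mapE tens_maprE.
Qed.

Lemma tens_coord_natural (N N' : lmodType R) (g : {linear N -> N'}) (X : choiceType) :
  exists (c : X -> {linear tens (free_mod R X) N -> N})
         (c' : X -> {linear tens (free_mod R X) N' -> N'}),
    (forall z, exists d : {fset X}, z = \sum_(x <- d) tensor (free_gen R x) (c x z)) /\
    forall x z, g (c x z) = c' x (tens_mapr (free_mod R X) g z).
Proof.
have [c [cE cD]] := tens_coord N X; have [c' [c'E _]] := tens_coord N' X.
exists c, c'; split=> // x.
apply: (tens_ext (f := g \o c x) (g := c' x \o tens_mapr (free_mod R X) g)) => m n.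
by rewrite /= tens_maprE cE c'E linearZ.
Qed.

(** * Exactness up to GV-torsion and tensor products *)

Definition GV_exact (A B C : lmodType R) (f : {linear A -> B}) (g : {linear B -> C}) :=
  (forall a, GV_killed (g (f a))) /\
  forall b, g b = 0 -> exists2 s, GVseq s & forall j, j \in s -> exists a, j *: b = f a.

Definition GV_surjective (A B : lmodType R) (f : {linear A -> B}) :=
  forall b, exists2 s, GVseq s & forall j, j \in s -> exists a, j *: b = f a.

Lemma GV_killed_coker (A B : lmodType R) (f : {linear A -> B}) :
  exists T : submodClosed B, forall b, GV_killed (quot_pi T b) <->
    exists2 s, GVseq s & forall j, j \in s -> exists a, j *: b = f a.
Proof.
have [T TE] := submod_pack (im_submod_closed f); exists T => b.
rewrite GV_killed_quot; split=> -[s sG h]; exists s => // j /h.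
  by rewrite TE => /asboolP[a aE]; exists a.
by move=> [a aE]; rewrite TE; apply/asboolP; exists a.
Qed.

Lemma tens_GV_surjective (P M N : lmodType R) (e : {linear M -> N}) :
  GV_surjective e -> GV_surjective (tens_mapr P e).
Proof.
move=> he z; have [T TP] := GV_killed_coker (tens_mapr P e); apply/TP.
have [t ->] := tens_elemE z; rewrite linear_sum; apply: GV_killed_sum => p.
apply/TP; have [s sG hs] := he p.2; exists s => // j /hs[a aE].
by exists (tensor p.1 a); rewrite tens_maprE -aE -linearZr_LR.
Qed.

Lemma tens_free_GV_exact (X : choiceType) (A B C : lmodType R)
    (f : {linear A -> B}) (g : {linear B -> C}) z :
  GV_exact f g -> tens_mapr (free_mod R X) g z = 0 ->
  exists2 s, GVseq s & forall j, j \in s -> exists w, j *: z = tens_mapr (free_mod R X) f w.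
Proof.
move=> [_ fg] z0; have [T TP] := GV_killed_coker (tens_mapr (free_mod R X) f); apply/TP.
have [c [c' [cD cE]]] := tens_coord_natural g X.
have [d ->] := cD z; rewrite linear_sum; apply: GV_killed_sum => x.
apply/TP; have [|s sG hs] := fg (c x z); first by rewrite cE z0 linear0.
exists s => // j /hs[a aE]; exists (tensor (free_gen R x) a).
by rewrite tens_maprE -aE -linearZr_LR.
Qed.

Lemma tens_free_GV_injective (X : choiceType) (A B : lmodType R) (f : {linear A -> B}) z :
  (forall a, f a = 0 -> GV_killed a) -> tens_mapr (free_mod R X) f z = 0 -> GV_killed z.
Proof.
move=> fI z0; have [c [c' [cD cE]]] := tens_coord_natural f X.
have [d ->] := cD z; apply: GV_killed_sum => x.
have [|s sG hs] := fI (c x z); first by rewrite cE z0 linear0.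
by exists s => // j js; rewrite -linearZr_LR hs // linear0r.
Qed.

(* Tor_2(X, M) = Tor_1(S1, M) is the kernel of S2 (x) M -> res_1 (x) M; a
   resolution 0 -> F1 -> F0 -> M -> 0 up to GV-torsion compares it with
   Tor_1(S1, F0) and Tor_1(X, F1). *)
Lemma GV_resolution_Tor2 (X S1 S2 F1 F0 M : lmodType R)
    (i1 : {linear S1 -> free_mod R X}) (i2 : {linear S2 -> free_mod R S1})
    (d : {linear F1 -> F0}) (e : {linear F0 -> M}) :
  is_syzygy i2 ->
  (forall z, tens_map F1 i1 z = 0 -> GV_killed z) ->
  (forall z, tens_map F0 i2 z = 0 -> GV_killed z) ->
  (forall a, d a = 0 -> GV_killed a) -> GV_exact d e -> GV_surjective e ->
  forall z, tens_map M i2 z = 0 -> GV_killed z.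
Proof.
move=> i2P flat1 flat0 dI de eS z z0.
have [s sG hs] := tens_GV_surjective eS z.
apply: (GV_killed_trans sG) => j /hs[y zE].
have : tens_map M i2 (tens_mapr S2 e y) = 0 by rewrite -zE linearZ_LR z0 scaler0.
rewrite zE => {z z0 s sG hs j zE}.
(* With [y] lifting a multiple of the initial element, its image in the free module over F0 comes
   from some [w] over F1, up to a GV-ideal. *)
rewrite tens_map_mapr => /(tens_free_GV_exact de)[s sG hs].
apply: (GV_killed_trans sG) => j /hs[w]; rewrite -!linearZ_LR => {s sG hs}.
move: (j *: y) => {}y yE.
(* The image of [w] in S1 (x) F1 is sent to 0 by [d], so [i1] sends it to a GV-killed element, and
   [flat1] applies. *)
have wbar : GV_killed (tens_map F1 (free_cover S1) w).
  have w0 : tens_mapr S1 d (tens_map F1 (free_cover S1) w) = 0.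
    rewrite -tens_map_mapr -yE -(tens_map_comp (h := \0)) => [|x]; last first.
      by apply/esym/i2P.2; exists x.
    have [t ->] := tens_elemE y; rewrite linear_sum big1 // => p _.
    by rewrite tens_mapE linear0l.
  have [|s sG hs] := tens_free_GV_injective
      (z := tens_map F1 i1 (tens_map F1 (free_cover S1) w)) dI.
    by rewrite -tens_map_mapr w0 linear0.
  apply: (GV_killed_trans sG) => k ks; apply: flat1.
  by rewrite linearZ_LR hs.
have [s sG hs] := wbar.
apply: (GV_killed_trans sG) => k ks.
(* A multiple of [w] now comes from [v] in S2 (x) F1. The difference of [k *: y] and the image of
   [v] is killed by [flat0], and [e] takes that image to a GV-killed element. *)
have [|v vE] := @tens_cover_exact _ F1 _ _ i2 i2P (k *: w); first by rewrite linearZ_LR hs.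
have /flat0/(GV_killed_linear (tens_mapr S2 e)) : tens_map F0 i2 (k *: y - tens_mapr S2 d v) = 0.
  by apply/eqP; rewrite linearB subr_eq0 linearZ_LR yE tens_map_mapr vE linearZ_LR.
have kv : GV_killed (tens_mapr S2 e (tens_mapr S2 d v)).
  have [t ->] := tens_elemE v; rewrite !linear_sum; apply: GV_killed_sum => p.
  rewrite !tens_maprE; have [u uG hu] := de.1 p.2.
  by exists u => // l lu; rewrite -linearZr_LR hu // linear0r.
by move=> /GV_killedD/(_ kv); rewrite -linearD subrK linearZ_LR.
Qed.

Lemma w_exact_GV_exact (A B C : lmodType R) (f : {linear A -> B}) (g : {linear B -> C}) :
  w_exact f g -> GV_exact f g.
Proof.
move=> h; split=> [a|b b0].
  apply: GV_killed_local => p pm.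
  have /(h p pm) : exists x, loc_map f x = loc_pi (f a, den_one (prime_compl p)).
    by exists (loc_pi (a, den_one (prime_compl p))); rewrite loc_mapE.
  rewrite loc_mapE => /loc_piP[u uS].
  by rewrite /= mulr1 scaler0 => ua; exists u.
apply: GV_range_local => p pm.
have /(h p pm)[x] : loc_map g (loc_pi (b, den_one (prime_compl p))) = 0.
  by rewrite loc_mapE /= b0.
rewrite -[x]loc_pi_repr loc_mapE; case: (repr x) => a s /loc_piP[u uS] /= e.
exists (u * sval s), (u *: a); split.
  exact: (@rpredM _ (prime_compl p) _ _ uS (svalP s)).
by rewrite linearZ_LR -e mulr1.
Qed.

Lemma w_surjective_GV_surjective (A B : lmodType R) (f : {linear A -> B}) :
  w_surjective f -> GV_surjective f.
Proof.
move=> h b; apply: GV_range_local => p pm.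
have [x] := h p pm (loc_pi (b, den_one (prime_compl p))).
rewrite -[x]loc_pi_repr loc_mapE; case: (repr x) => a s /loc_piP[u uS] /= e.
exists (u * sval s), (u *: a); split.
  exact: (@rpredM _ (prime_compl p) _ _ uS (svalP s)).
by rewrite linearZ_LR -e mulr1.
Qed.

Lemma w_wgldim_Tor2 : w_wgldim_le R 1 -> forall X M : lmodType R, GV_torsion (Tor X M 2).
Proof.
move=> h X M; have [F [d [e [Fflat F0 eS de dd]]]] := h M.
have flat i n z : tens_map (F i) (syz_val X n) z = 0 -> GV_killed z.
  exact: (GV_torsion_Tor (syz X n) (F i) 0).1 (Fflat i (syz X n)) z.
apply/GV_torsion_Tor.
apply: (GV_resolution_Tor2 (syz_val_syzygy X 1) (flat 1 0) (flat 0 1) _ (w_exact_GV_exact de)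
  (w_surjective_GV_surjective eS)) => a a0.
(* The term of degree 2 is zero, so exactness makes [d 0] injective up to GV-torsion. *)
have [s sG hs] := (w_exact_GV_exact (dd 0)).2 a a0; exists s => // j /hs[b ->].
by rewrite (F0 2 _ b) // linear0.
Qed.

Lemma exact_w_exact (A B C : lmodType R) (f : {linear A -> B}) (g : {linear B -> C}) :
  (forall b, g b = 0 <-> exists a, f a = b) -> w_exact f g.
Proof.
move=> fg p _ y; rewrite -[y]loc_pi_repr; case: (repr y) => b s.
split=> [|[x]].
  rewrite loc_mapE => /loc_piP[u uS]; rewrite /= scaler0 mulr1 -linearZ_LR => /fg[a aE].
  exists (loc_pi (a, den_mul (exist _ u uS) s)); rewrite loc_mapE; apply: loc_pi_eq.
  by rewrite /= aE scalerA mulrC.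
rewrite -[x]loc_pi_repr; case: (repr x) => a t; rewrite loc_mapE => <-.
have gfa : g (f a) = 0 by apply/fg; exists a.
by rewrite loc_mapE; apply: loc_pi_eq; rewrite /= gfa !scaler0.
Qed.

(** The canonical cover of M and its kernel suffice, both being torsion-free, hence w-flat; row
    vectors of length 0 serve as zero modules. *)
Lemma flat_w_wgldim :
  (forall X A : lmodType R, torsion_free A -> GV_torsion (Tor X A 1)) -> w_wgldim_le R 1.
Proof.
move=> h M.
pose F n : lmodType R :=
  match n with 0 => res M 0 | 1 => syz M 1 | _ => 'rV[R]_0 end.
pose d n : {linear F n.+1 -> F n} :=
  match n return {linear F n.+1 -> F n} with 0 => syz_val M 0 | _ => \0 end.
have tf0 : torsion_free (free_mod R M).
  move=> a x /malgP ax; have [->|a0] := eqVneq a 0; [by left|right].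
  apply/malgP => k; have := ax k; rewrite mcoeffZ !mcoeff0 => /eqP.
  by rewrite mulf_eq0 (negbTE a0) => /eqP.
have [iI iE] := syz_val_syzygy M 0.
exists F, d, (free_cover M); split.
- move=> [|[|n]] N; apply: h => //=.
    move=> a x ax; have /tf0[->|x0] : a *: syz_val M 0 x = 0 by rewrite -linearZ_LR ax linear0.
      by left.
    by right; apply: iI; rewrite x0 linear0.
  by move=> a x _; right; exact: thinmx0.
- by move=> [|[|n]] // _ x; exact: thinmx0.
- move=> p _ y; rewrite -[y]loc_pi_repr; case: (repr y) => m s.
  by exists (loc_pi (free_gen R m, s)); rewrite loc_mapE /= free_cover_gen.
- exact: exact_w_exact.
- move=> [|n]; apply: exact_w_exact => b; split=> [b0|[a <-]].
  + by exists 0; apply: iI; apply: (etrans _ (esym b0)); exact: (linear0 (syz_val M 0)).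
  + exact: (linear0 (syz_val M 0)).
  + by exists 0; case: n b {b0} => [|n] b; rewrite [b]thinmx0.
  + by case: n b a => [|n].
Qed.

(* With I = (a, b), Tor_2(R/I, R/I) is the kernel of I (x) I -> I; the element
   a (x) b - b (x) a has annihilator contained in (a : b) + (b : a). *)
Lemma Tor2_comparable :
  (forall X M : lmodType R, GV_torsion (Tor X M 2)) -> comparable_w R.
Proof.
(* The argument ends by cancelling [b], so [b = 0] is settled first. *)
move=> h a b; have [b0|b0] := eqVneq b 0.
  exists [:: 1]; first exact: GVseq1.
  move=> j; rewrite inE => /eqP->; exists 1, 0; rewrite b0 addr0 mulr0 mul0r.
  by split=> //; exists 0; rewrite mulr0.
have [N [NP Nrel]] := colon_sum a b.
have NM (x y : R) : y \in N -> x * y \in N by exact: (@rpredZ _ _ N x y).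
have Icl : submod_closed (fun i : R^o => `[< exists c d : R, (i : R) = c * a + d * b >]).
  split; first by apply/asboolP; exists 0, 0; rewrite !mul0r addr0.
  move=> r _ _ /asboolP[c [d ->]] /asboolP[c' [d' ->]]; apply/asboolP.
  exists (r * c + c'), (r * d + d').
  by change (r * (c * a + d * b) + (c' * a + d' * b) = (r * c + c') * a + (r * d + d') * b); ring.
have [I IE] := submod_pack Icl.
have IP (i : R) : i \in I <-> exists c d, i = c * a + d * b.
  by rewrite IE; split=> [/asboolP|?]; last exact/asboolP.
(* The detecting map takes values in R / bN, and will send the chosen element to the class of
   [b]. *)
have bNcl : submod_closed (fun i : R^o => `[< exists2 n : R, n \in N & (i : R) = b * n >]).
  split; first by apply/asboolP; exists 0; rewrite ?mulr0 //; exact: (rpred0 N).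
  move=> r _ _ /asboolP[n nN ->] /asboolP[n' n'N ->]; apply/asboolP.
  exists (r * n + n'); first by apply: (rpredD (NM r n nN)).
  by change (r * (b * n) + b * n' = b * (r * n + n')); ring.
have [B BE] := submod_pack bNcl.
have BP (i : R) : i \in B <-> exists2 n, n \in N & i = b * n.
  by rewrite BE; split=> [/asboolP|?]; last exact/asboolP.
have [bN aN] : b \in N /\ - a \in N by apply: Nrel; ring.
have IN (i : R) : i \in I -> i \in N.
  move=> /IP[c [d ->]]; have -> : c * a + d * b = (- c) * (- a) + d * b by ring.
  by apply: rpredD; apply: NM.
(* I multiplies the first coefficient of a relation between [a] and [b] into bN, so pairing it with
   R / I makes sense modulo bN. *)
have relB (i x y : R) : i \in I -> x * a + y * b = 0 -> i * x \in B.
  move=> /IP[c [d ->]] xy; have [xN yN] := Nrel _ _ xy.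
  apply/BP; exists (d * x + (- c) * y); first by apply: rpredD; apply: NM.
  have xa : x * a = - (y * b) by apply/eqP; rewrite -addr_eq0 xy.
  transitivity (c * (x * a) + d * b * x); first by ring.
  by rewrite xa; ring.
pose M := quotm I.
pose S1 := syz M 1; pose i1 : {linear S1 -> free_mod R M} := syz_val M 0.
pose S2 := syz M 2; pose i2 : {linear S2 -> free_mod R S1} := syz_val M 1.
have [i1I i1E] := syz_val_syzygy M 0; have [i2I i2E] := syz_val_syzygy M 1.
have flat (z : tens S2 M) : tens_map M i2 z = 0 -> GV_killed z.
  exact: (GV_torsion_Tor M M 1).1 (h M M) z.
rewrite -/i1 in i1I i1E; rewrite -/i2 in i2I i2E.
rewrite -/S1 -/S2 in i1 i1I i1E i2 i2I i2E flat.
move: S1 S2 i1 i2 i1I i1E i2I i2E flat => S1 S2 i1 i2 i1I i1E i2I i2E flat.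
pose e1 : M := quot_pi I 1.
have e1Z (r : R) : r *: e1 = quot_pi I r.
  by rewrite /e1 -linearZ; congr quot_pi; rewrite -[r *: 1]/(r * 1) mulr1.
have e1I (r : R) : r \in I -> r *: e1 = 0.
  by move=> rI; rewrite e1Z -(linear0 (quot_pi I)); apply/quot_piP; rewrite subr0.
have aI : a \in I by apply/IP; exists 1, 0; ring.
have bI : b \in I by apply/IP; exists 0, 1; ring.
have [sa saE] : exists s, i1 s = a *: free_gen R e1.
  by apply/i1E; rewrite linearZ_LR free_cover_gen e1I.
have [sb sbE] : exists s, i1 s = b *: free_gen R e1.
  by apply/i1E; rewrite linearZ_LR free_cover_gen e1I.
(* A Koszul-type relation between the syzygies of [a] and [b]; tensored with the class of 1, it dies
   in the free module. *)
have [sg sgE] : exists s, i2 s = b *: free_gen R sa - a *: free_gen R sb.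
  have rel0 : b *: sa - a *: sb = 0.
    by apply: i1I; rewrite linear0 linearB !(linearZ_LR i1) saE sbE !scalerA mulrC subrr.
  by apply/i2E; rewrite linearB !(linearZ_LR (free_cover S1)) !free_cover_gen.
have /flat zK : tens_map M i2 (tensor sg e1) = 0.
  rewrite tens_mapE sgE linearBl !linearZl_LR -!linearZr_LR /=.
  by rewrite !e1I // !linear0r subrr.
pose rep : M -> R^o := repr.
have repI (q : M) : quot_pi I (rep q) = q by exact: quot_pi_repr.
have repD r q q' : rep (r *: q + q') - (r * rep q + rep q' : R) \in I.
  apply/quot_piP; apply: (etrans (repI _)).
  transitivity (r *: quot_pi I (rep q) + quot_pi I (rep q')); first by rewrite !repI.
  by rewrite -linearP.
(* [beta] lifts the cover of R / I to R, so it maps first syzygies into I. *)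
pose beta : {linear free_mod R M -> R^o} := free_lift rep.
have betag y : beta (free_gen R y) = rep y by exact: free_lift_gen.
have betaI t : beta (i1 t) \in I.
  rewrite -[X in X \in I]subr0; apply/quot_piP; rewrite linear0.
  rewrite -[LHS]/((quot_pi I \o beta) (i1 t)).
  rewrite (free_ext (g := free_cover M)); first by apply/i1E; exists t.
  by move=> x; rewrite /= !free_lift_gen repI.
have /choice[c /choice[d cdE]] (t : S1) : exists c d : R, beta (i1 t) = c * a + d * b :> R.
  exact/IP.
(* The chosen coefficients need not be linear on S1, but extend linearly to the free module on
   S1. *)
pose th : {linear free_mod R S1 -> R^o} := free_lift (c : S1 -> R^o).
pose th' : {linear free_mod R S1 -> R^o} := free_lift (d : S1 -> R^o).
have thg t : th (free_gen R t) = c t by exact: free_lift_gen.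
have thP r x y : th (r *: x + y) = r * th x + th y :> R by exact: linearP.
have th'P r x y : th' (r *: x + y) = r * th' x + th' y :> R by exact: linearP.
(* The combination of [th] and [th'] is [beta] after [i1] after the cover of S1, which vanishes on
   second syzygies. *)
have thE (s : S2) : (th (i2 s) : R) * a + (th' (i2 s) : R) * b = 0.
  have lF : linear (fun g : free_mod R S1 => (th g : R) * a + (th' g : R) * b : R^o).
    have E r x y : (th (r *: x + y) : R) * a + (th' (r *: x + y) : R) * b =
        r * ((th x : R) * a + (th' x : R) * b) + ((th y : R) * a + (th' y : R) * b).
      by rewrite thP th'P; ring.
    exact: E.
  have [G GE] := linear_pack lF.
  rewrite -[LHS]GE (free_ext (g := beta \o i1 \o free_cover S1)) => [|x]; last first.
    by rewrite GE /= /th /th' !free_lift_gen -[LHS]cdE.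
  have e0 : free_cover S1 (i2 s) = 0 by apply/i2E; exists s.
  apply: (etrans (congr1 (fun t => beta (i1 t)) e0)).
  by rewrite !linear0.
have thB i s : i \in I -> i * (th (i2 s) : R) \in B.
  by move=> iI; apply: relB iI (thE s).
(* [rep] is linear only modulo I, an error absorbed by [thB]. *)
have [L LE] : exists L : {linear tens S2 M -> quotm B},
    forall s q, L (tensor s q) = quot_pi B ((rep q : R) * (th (i2 s) : R)).
  apply: tens_ump => [q r s s'|s r q q'].
    rewrite -linearP; congr quot_pi; rewrite [i2 _]linearP thP.
    change ((rep q : R) * (r * (th (i2 s) : R) + (th (i2 s') : R)) =
      r * ((rep q : R) * (th (i2 s) : R)) + (rep q : R) * (th (i2 s') : R)).
    by ring.
  rewrite -linearP; apply/quot_piP.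
  have := thB _ s (repD r q q').
  set t : R := th (i2 s); set x : R := rep (r *: q + q').
  set y : R := rep q; set w : R := rep q'.
  by rewrite mulrBl mulrDl -mulrA.
have := GV_killed_linear L zK; rewrite LE.
set r0 : R := rep e1.
have r0I : r0 - 1 \in I by apply/quot_piP; rewrite repI.
have betae x : beta (x *: free_gen R e1) = x * r0 :> R.
  apply: (etrans (linearZ_LR beta _ _)).
  by rewrite betag.
have thsg : th (i2 sg) = b * c sa - a * c sb :> R.
  rewrite sgE linearB !(linearZ_LR th).
  by rewrite !thg.
have [caN _] : c sa - r0 \in N /\ d sa \in N.
  apply: Nrel; have := cdE sa; rewrite saE betae => e.
  by rewrite mulrBl addrAC -e; ring.
have [cbN dbN] : c sb \in N /\ d sb - r0 \in N.
  apply: Nrel; have := cdE sb; rewrite sbE betae => e.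
  by rewrite mulrBl addrA -e; ring.
(* Modulo N, both [c sa] and [d sb] are congruent to [r0], hence to 1, while
   [b * r0 = c sb * a + d sb * b]. *)
have -> : quot_pi B (r0 * (th (i2 sg) : R)) = quot_pi B b.
  apply/quot_piP.
  have -> : r0 * (th (i2 sg) : R) - b = (r0 - 1) * (th (i2 sg) : R) +
      b * ((c sa - r0) + (r0 - 1) + (d sb - r0)) + (a * c sb + d sb * b - b * r0) * (-1) :> R.
    by rewrite thsg; ring.
  have -> : a * c sb + d sb * b - b * r0 = 0 :> R.
    by have := cdE sb; rewrite sbE betae => ->; ring.
  rewrite mul0r addr0; apply: rpredD; first exact: thB.
  apply/BP; exists (c sa - r0 + (r0 - 1) + (d sb - r0)) => //.
  by apply: rpredD => //; apply: rpredD => //; apply: IN.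
move=> /GV_killed_quot[s sG hs]; exists s => // j /hs.
move=> /BP[n nN jb]; apply/NP; have -> : j = n by apply: (mulfI b0); rewrite mulrC; exact: jb.
exact: nN.
Qed.

End TorTwo.

Theorem theorem3p2 (R : idomainType) :
  [<->
     PvMD R;
     forall M N : lmodType R, GV_torsion (Tor M N 2);
     w_wgldim_le R 1;
     forall X A : lmodType R, torsion_free A -> GV_torsion (Tor X A 1);
     forall (T S : algType {fraction R})
       (A : subalgClosed (restr R T)) (B : subalgClosed (restr R S)),
       GV_torsion (submod (ker (mu A B)));
     forall (T S : algType {fraction R})
       (A : subalgClosed (restr R T)) (B : subalgClosed (restr R S)),
       w_injective (mu A B)].
Proof.
have flat : comparable_w R ->
    forall X A : lmodType R, torsion_free A -> GV_torsion (Tor X A 1).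
  move=> cR X A tfA; apply/GV_torsion_Tor.
  by apply: comparable_syzygy_flat => //; case: (syz_val_syzygy X 0).
have mu_killed : comparable_w R -> forall (T S : algType {fraction R})
    (A : subalgClosed (restr R T)) (B : subalgClosed (restr R S)),
    GV_torsion (submod (ker (mu A B))).
  by move=> cR T S A B; apply/GV_torsion_ker/comparable_mu_killed.
(* In this cycle, every implication except that between the two forms of (4) passes through
   w-comparability. *)
tfae=> [/PvMD_comparable|/Tor2_comparable|/w_wgldim_Tor2/Tor2_comparable|h|h|h].
- by move=> /flat/flat_w_wgldim/w_wgldim_Tor2.
- by move=> /flat/flat_w_wgldim.
- exact: flat.
- exact/mu_killed/Tor2_comparable/w_wgldim_Tor2/flat_w_wgldim.
- by move=> T S A B; apply/w_injectiveP/GV_torsion_ker.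
- by apply/comparable_PvMD/mu_comparable => T S A B; apply/w_injectiveP.
Qed.
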